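(* Let Assumption A hold and let $x^*$ be the unique optimal solution of the bilevel problem. Let $\{\eta_k\}_{k\ge0}$ be positive and nonincreasing, and let $\{x_k\}$ be generated by IR-VFISTA$_s$ (see context). (i) If $\lim_{k\to\infty}\eta_k=0$, $\sum_{k=0}^\infty\sqrt{\eta_k}=\infty$, and $\lim_{k\to\infty}\frac{\eta_k-\eta_{k+1}}{\eta_{k+1}\sqrt{\eta_k}}=0$, then $\lim_{k\to\infty}x_k=x^*$. (ii) Suppose $X^*_{\bar h}$ is $\alpha$-weak sharp of order $m\in(1,2]$ and $\eta_k=\eta_0(k+1)^{-a}$ with $a\in(0,2)$ and $\eta_0>0$. Then, for $K\ge1$ (with constants in $\mathcal{O}(\cdot)$ independent of $K$): (ii.1) $0\le\bar h(x_K)-\bar h(x^* )\le\mathcal{O}\left(K^{-\frac{am}{m-1}}\right)$. (ii.2) $-\mathcal{O}\left(K^{-\frac{a}{m-1}}\right)\le\bar f(x_K)-\bar f(x^* )\le\mathcal{O}\left(K^{-1-\frac{a(3-m)}{2(m-1)}}\right)$. (ii.3) $\|x_K-x^*\|^2\le\mathcal{O}\left(K^{-\frac{a}{m-1}}\right)$.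
   Context: Problem: minimize $\bar f(x):=f(x)+\omega_f(x)$ over $x\in X^*_{\bar h}:=\arg\min_{x\in\mathbb{R}^n}\bar h(x)$, where $\bar h:=h+\omega_h$. Norms are Euclidean. Assumption A: (i) $f:\mathbb{R}^n\to\mathbb{R}$ is $L_f$-smooth (differentiable with $L_f$-Lipschitz gradient) and $\mu_f$-strongly convex ($\mu_f>0$); (ii) $h:\mathbb{R}^n\to\mathbb{R}$ is convex and $L_h$-smooth ($L_h>0$); (iii) $\omega_f,\omega_h:\mathbb{R}^n\to(-\infty,\infty]$ are proper, closed, convex; (iv) $X^*_{\bar h}\neq\emptyset$; (v) $\inf_{x\in\mathbb{R}^n}\bar f(x)>-\infty$; (vi) the unique optimal solution $x^*$ of the problem lies in $\mathrm{int}(\mathrm{dom}(\omega_f))$; (vii) $\mathrm{ri}(\mathrm{dom}(\omega_f))\cap X^*_{\bar h}\ne\emptyset$. Notation: $\bar h^*:=\inf\bar h$, $\omega_\eta:=\omega_h+\eta\omega_f$, $\mathrm{prox}_{g}[x]:=\arg\min_u\{g(u)+\frac12\|u-x\|^2\}$. $X^*_{\bar h}$ is $\alpha$-weak sharp of order $m$ if $\alpha>0$ and $\bar h(x)-\bar h^*\ge\alpha\,\mathrm{dist}^m(x,X^*_{\bar h})$ for all $x\in\mathbb{R}^n$. IR-VFISTA$_s$: given $y_0=x_0\in\mathbb{R}^n$ and $\{\eta_k\}$, put $\kappa_k:=\frac{L_h+\eta_kL_f}{\eta_k\mu_f}$, $\gamma_k:=\frac{1}{L_h+\eta_kL_f}$,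 and for $k=0,1,\dots$: $x_{k+1}:=\mathrm{prox}_{\gamma_k\omega_{\eta_k}}[y_k-\gamma_k(\nabla h(y_k)+\eta_k\nabla f(y_k))]$, $y_{k+1}:=x_{k+1}+\frac{\sqrt{\kappa_k}-1}{\sqrt{\kappa_{k+1}}+1}(x_{k+1}-x_k)$. *)

(* Defs.v *)
From HB Require Import structures.
From mathcomp Require Import all_boot all_order all_algebra.
From mathcomp Require Import all_classical all_reals all_analysis.

Set Implicit Arguments.
Unset Strict Implicit.
Unset Printing Implicit Defensive.

Import Order.TTheory GRing.Theory Num.Theory.
Import numFieldNormedType.Exports.

Local Open Scope classical_set_scope.
Local Open Scope ring_scope.

(* The canonical norm on ['rV[R]_n] is the sup norm.  It induces the Euclidean *)
(* topology, so the library's topological notions (interior, closed, limits,   *)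
(* differentiability) apply unchanged, but metric quantities use [enorm].      *)
Section Euclidean.
Context {R : realType} {n : nat}.
Implicit Types (x v : 'rV[R]_n) (A : set 'rV[R]_n).

Definition enorm v : R := Num.sqrt (\sum_(i < n) v 0 i ^+ 2).

Definition dist x A : R := inf [set enorm (x - z) | z in A].

Definition affine_set A : Prop :=
  forall x v (t : R), A x -> A v -> A ((1 - t) *: x + t *: v).

Definition affine_hull A : set 'rV[R]_n := smallest affine_set A.

Definition relint A : set 'rV[R]_n :=
  [set x | A x /\ exists2 r : R, 0 < r &
    forall v, affine_hull A v -> enorm (v - x) < r -> A v].

(* The vector representing the differential ['d f x]; meaningful only where   *)
(* [f] is differentiable.                                                      *)
Definition gradient (f : 'rV[R]_n -> R) x : 'rV[R]_n :=
  \row_(i < n) 'd f x (delta_mx 0 i).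

Definition smooth (L : R) (f : 'rV[R]_n -> R) : Prop :=
  (forall x, differentiable f x) /\
  (forall x v, enorm (gradient f x - gradient f v) <= L * enorm (x - v)).

Definition strongly_convex (mu : R) (f : 'rV[R]_n -> R) : Prop :=
  forall x v (t : R), 0 <= t -> t <= 1 ->
    f (t *: x + (1 - t) *: v) <=
    t * f x + (1 - t) * f v - mu / 2 * t * (1 - t) * enorm (x - v) ^+ 2.

End Euclidean.

Section ExtendedValued.
Context {R : realType} {n : nat}.
Implicit Types (g : 'rV[R]_n -> \bar R) (x u : 'rV[R]_n).
Local Open Scope ereal_scope.

Definition dom g : set 'rV[R]_n := [set x | g x < +oo].

Definition proper_function g : Prop :=
  (forall x, -oo < g x) /\ dom g !=set0.

Definition closed_function g : Prop :=
  closed [set p : 'rV[R]_n * R | g p.1 <= p.2%:E].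

(* For the proper functions considered here the right-hand side never has the  *)
(* form [+oo - oo]; at the end points the convention [0 * +oo = 0] is harmless. *)
Definition econvex_function g : Prop :=
  forall x u (t : R), (0 <= t)%R -> (t <= 1)%R ->
    g (t *: x + (1 - t) *: u)%R <= t%:E * g x + (1 - t)%:E * g u.

Definition argmin (A : set 'rV[R]_n) g : set 'rV[R]_n :=
  [set x | A x /\ forall u, A u -> g x <= g u].

(* As a set; a singleton when [g] is proper, closed and convex. *)
Definition prox g x : set 'rV[R]_n :=
  argmin setT (fun u => g u + (2^-1 * enorm (u - x) ^+ 2)%:E).

Definition composite (f : 'rV[R]_n -> R) (w : 'rV[R]_n -> \bar R) x : \bar R :=
  (f x)%:E + w x.

Definition weak_sharp (alpha m : R) g : Prop :=
  (0 < alpha)%R /\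
  forall x, (alpha * dist x (argmin setT g) `^ m)%:E <=
            g x - ereal_inf (range g).

Record bilevel_assumptions (f h : 'rV[R]_n -> R) (wf wh : 'rV[R]_n -> \bar R)
    (Lf muf Lh : R) (xs : 'rV[R]_n) : Prop := BilevelAssumptions {
  f_smooth : smooth Lf f ;
  muf_gt0 : (0 < muf)%R ;
  f_strongly_convex : strongly_convex muf f ;
  h_convex : convex_function setT h ;
  Lh_gt0 : (0 < Lh)%R ;
  h_smooth : smooth Lh h ;
  wf_proper : proper_function wf ;
  wf_closed : closed_function wf ;
  wf_convex : econvex_function wf ;
  wh_proper : proper_function wh ;
  wh_closed : closed_function wh ;
  wh_convex : econvex_function wh ;
  lower_solutions_nonempty : argmin setT (composite h wh) !=set0 ;
  upper_bounded_below : -oo < ereal_inf (range (composite f wf)) ;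
  unique_solution :
    argmin (argmin setT (composite h wh)) (composite f wf) = [set xs] ;
  solution_interior : (dom wf)° xs ;
  relint_meets : relint (dom wf) `&` argmin setT (composite h wh) !=set0 }.

End ExtendedValued.

Section Algorithm.
Context {R : realType} {n : nat}.

Definition kappa (Lf muf Lh : R) (eta : R^nat) (k : nat) : R :=
  (Lh + eta k * Lf) / (eta k * muf).

Definition gamma (Lf Lh : R) (eta : R^nat) (k : nat) : R :=
  (Lh + eta k * Lf)^-1.

Definition IR_VFISTA (f h : 'rV[R]_n -> R) (wf wh : 'rV[R]_n -> \bar R)
    (Lf muf Lh : R) (eta : R^nat) (x y : nat -> 'rV[R]_n) : Prop :=
  let kap := kappa Lf muf Lh eta in
  let gam := gamma Lf Lh eta in
  [/\ y 0%N = x 0%N,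
      (forall k, prox (fun u => (gam k)%:E * (wh u + (eta k)%:E * wf u))%E
         (y k - gam k *: (gradient h (y k) + eta k *: gradient f (y k)))
         (x k.+1)) &
      (forall k, y k.+1 = x k.+1 +
         ((Num.sqrt (kap k) - 1) / (Num.sqrt (kap k.+1) + 1)) *:
           (x k.+1 - x k))].

End Algorithm.

(* Main.v *)
Require Import Defs.
From mathcomp Require Import all_boot all_order all_algebra.
From mathcomp Require Import all_classical all_reals all_analysis.
From mathcomp Require Import ring lra.

Import Order.TTheory GRing.Theory Num.Theory.
Import numFieldNormedType.Exports.

Local Open Scope classical_set_scope.
Local Open Scope ring_scope.

(* The solution [xs] itself is the reference point of the energy               *)
(*   E_k = hbar (x_k) - hbar (xs)                                              *)
(*         + eta_k (fbar (x_k) - fbar (xs) + muf / 2 |v_k - xs|^2),            *)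
(* so that no moving minimizer has to be tracked.  The momentum coefficient is *)
(* exactly the one for which v_{k+1} = x_k + sqrt (kappa_k) (x_{k+1} - x_k)    *)
(* satisfies the relation of Nesterov's scheme with theta_k = kappa_k^{-1/2},  *)
(* hence a step at frozen eta_k contracts E by 1 - theta_k, and decreasing     *)
(* eta_k costs (eta_k - eta_{k+1}) (fbar (xs) - fbar (x_{k+1})).               *)
(* (i) As fbar is bounded below, E_k / eta_k has nonpositive upper limit; by   *)
(* lower semicontinuity and uniqueness, xs is the only cluster point.          *)
(* (ii) As [xs] is interior to the domain of [wf], fbar is bounded above near  *)
(* it, and shrinking towards [xs] gives the exact penalty bound                *)
(*   fbar (u) - fbar (xs) >= muf / 2 |u - xs|^2 - M dist (u, X).               *)
(* With weak sharpness and Young's inequality the cost of decreasing eta_k is  *)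
(* O(1/k) (E_k + eta_k^{m/(m-1)}), and E_k = O(k^-q) follows, where            *)
(* q = 1 + a/2 + a/(m-1).                                                      *)

Set Implicit Arguments.
Unset Strict Implicit.
Unset Printing Implicit Defensive.

(** * Euclidean inner product and smooth functions *)

(** For frozen [k] the function [hbar + eta_k fbar] is [eta_k muf]-strongly convex, and the method
    makes a Nesterov step on it with rate [theta_k = kappa_k^(-1/2)], at least a constant times
    [sqrt eta_k]. The contraction persists when the energy is measured against [xs] instead of the
    minimizer of that function ([accelerated_step], [energy_step]); the price is that the energy may
    be negative. For (i), divide the energy by [eta_k]. The change of weight perturbs the
    contraction only by [o(theta_k)], and the [theta_k] have infinite sum, so the quotient ends
    below every positive [e] ([perturbed_contraction_small]). Since the gap of [hbar] is
    nonnegative, the gap of [fbar] is eventually at most [e]; since [fbar] is bounded below, the gap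
    of [hbar] tends to 0. Quadratic growth around [xs] ([upper_growth]) bounds the iterates, and
    every cluster point solves the bilevel problem. For (ii), one must control how negative the gap
    of [fbar] can be. [exact_penalty] bounds it by a multiple of the distance to the lower solution
    set, weak sharpness charges this distance to [hbar], and [powR_young] balances the two. The
    resulting recursion is solved by [power_recursion], and all rates are read off from the decay of
    the energy. *)

Section Dot.
Context {R : realType} {n : nat}.
Implicit Types u v w : 'rV[R]_n.

Definition dot u v : R := \sum_(i < n) u 0 i * v 0 i.

Lemma dotC u v : dot u v = dot v u.
Proof. by apply: eq_bigr => i _; rewrite mulrC. Qed.

Lemma dotDl u v w : dot (u + v) w = dot u w + dot v w.
Proof.
by rewrite /dot -big_split/=; apply: eq_bigr => i _; rewrite mxE mulrDl.
Qed.

Lemma dotZl (c : R) u v : dot (c *: u) v = c * dot u v.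
Proof.
by rewrite /dot mulr_sumr; apply: eq_bigr => i _; rewrite mxE mulrA.
Qed.

Lemma dotNl u v : dot (- u) v = - dot u v.
Proof. by rewrite -scaleN1r dotZl mulN1r. Qed.

Lemma dotDr u v w : dot u (v + w) = dot u v + dot u w.
Proof. by rewrite dotC dotDl !(dotC u). Qed.

Lemma dotZr (c : R) u v : dot u (c *: v) = c * dot u v.
Proof. by rewrite dotC dotZl dotC. Qed.

Lemma dotNr u v : dot u (- v) = - dot u v.
Proof. by rewrite dotC dotNl dotC. Qed.

Definition dotE := (dotDl, dotDr, dotNl, dotNr, dotZl, dotZr).

Lemma dot_ge0 u : 0 <= dot u u.
Proof. by apply: sumr_ge0 => i _; rewrite -expr2 sqr_ge0. Qed.

Lemma enorm_sqr u : enorm u ^+ 2 = dot u u.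
Proof.
rewrite /enorm sqr_sqrtr; last by apply: sumr_ge0 => i _; rewrite sqr_ge0.
by apply: eq_bigr => i _; rewrite expr2.
Qed.

Lemma enorm_ge0 u : 0 <= enorm u.
Proof. exact: sqrtr_ge0. Qed.

Lemma enormZ (t : R) u : 0 <= t -> enorm (t *: u) = t * enorm u.
Proof.
move=> t0; apply: (@pexpIrn _ 2) => //; rewrite ?nnegrE ?mulr_ge0 ?enorm_ge0//.
by rewrite exprMn !enorm_sqr !dotE; ring.
Qed.

Lemma enormN u : enorm (- u) = enorm u.
Proof. by congr Num.sqrt; apply: eq_bigr => i _; rewrite mxE sqrrN. Qed.

Lemma dot_le_enorm u v : dot u v <= enorm u * enorm v.
Proof.
have : (dot u v) ^+ 2 <= dot u u * dot v v.
  have [/eqP|vv0] := boolP (dot v v == 0).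
    move=> vv0; rewrite vv0 mulr0.
    suff -> : dot u v = 0 by rewrite expr0n.
    apply: big1 => i _; suff -> : v 0 i = 0 by rewrite mulr0.
    have := vv0 => /eqP; rewrite psumr_eq0 => [|j _]; last first.
      by rewrite -expr2 sqr_ge0.
    by move=> /allP /(_ i (mem_index_enum _)) /= /eqP/eqP; rewrite mulf_eq0 orbb => /eqP.
  have vvgt0 : 0 < dot v v by rewrite lt_neqAle eq_sym vv0 dot_ge0.
  have := dot_ge0 (dot v v *: u - dot u v *: v).
  rewrite !dotE (dotC v u).
  set t := (X in 0 <= X); have -> : t = dot v v * (dot u u * dot v v - dot u v ^+ 2).
    by rewrite /t; ring.
  by rewrite pmulr_rge0// subr_ge0.
rewrite -!enorm_sqr -exprMn => uv.
rewrite (le_trans (ler_norm _))// -ler_sqr ?nnegrE ?mulr_ge0 ?enorm_ge0//.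
by rewrite real_normK ?num_real.
Qed.

Lemma norm_le_enorm u : `|u| <= enorm u.
Proof.
rewrite [`|u|]mx_normrE; apply/bigmax_leP; split => [|[i j] _] /=.
  exact: enorm_ge0.
rewrite -ler_sqr ?nnegrE ?enorm_ge0// enorm_sqr real_normK ?num_real//.
have -> : i = 0 by exact: ord1.
rewrite /dot (bigD1 j)//= -expr2 lerDl.
by apply: sumr_ge0 => k _; rewrite -expr2 sqr_ge0.
Qed.

End Dot.

Section RealLemmas.
Context {R : realType}.

(** Replaces every argument that divides by [t] and lets [t] tend to 0. *)
Lemma le_lim_small (A B C t0 : R) : 0 < t0 ->
  (forall t : R, 0 < t -> t < t0 -> B - t * C <= A) -> B <= A.
Proof.
move=> t0_gt0 H; apply/ler_addgt0Pl => e e0.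
have C0 : 0 < `|C| + 1 by rewrite ltr_wpDl.
pose t := Num.min (t0 / 2) (e / (`|C| + 1)).
have t_gt0 : 0 < t by rewrite lt_min !divr_gt0.
have t_lt : t < t0 by rewrite gt_min ltr_pdivrMr// ltr_pMr// ltr1n.
have := H _ t_gt0 t_lt; rewrite lerBlDr => /le_trans; apply.
rewrite addrC lerD2r; apply: (@le_trans _ _ (t * (`|C| + 1))).
  by rewrite ler_pM2l// (le_trans (ler_norm _))// lerDl.
by rewrite -ler_pdivlMr// ge_min lexx orbT.
Qed.

(** The mean value theorem, applied to [phi] minus its quadratic model at 0, takes the place of
    integrating [dphi]. *)
Lemma quadratic_upper_bound (phi dphi : R -> R) (C : R) :
  (forall t : R, is_derive t 1 phi (dphi t)) ->
  (forall t : R, 0 <= t -> dphi t - dphi 0 <= C * t) ->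
  phi 1 <= phi 0 + dphi 0 + C / 2.
Proof.
move=> dp Lp.
pose psi t := phi t - t * dphi 0 - C / 2 * t ^+ 2.
have dpsi (t : R) : is_derive t 1 psi (dphi t - dphi 0 - C * t).
  by apply: is_derive_eq; rewrite /GRing.scale/=; field.
have psi_cts : {within `[0, 1], continuous psi}.
  apply: continuous_subspaceT => t; apply: differentiable_continuous.
  by apply/derivable1_diffP; exact: ex_derive.
have [c] := @MVT R psi _ 0 1 ltr01 (fun t _ => dpsi t) psi_cts.
rewrite in_itv/= => /andP[c0 _].
have := Lp c (ltW c0); rewrite /psi; lra.
Qed.

End RealLemmas.

Section Gradient.
Context {R : realType} {n : nat}.
Implicit Types (f : 'rV[R]_n -> R) (x y u v : 'rV[R]_n).

Lemma diff_gradient f x v : differentiable f x -> 'd f x v = dot (gradient f x) v.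
Proof.
move=> df; rewrite {1}(row_sum_delta v) linear_sum/= /dot.
by apply: eq_bigr => i _; rewrite linearZ/= mxE mulrC.
Qed.

Lemma is_derive_line f y v (t : R) : (forall x, differentiable f x) ->
  is_derive t 1 (fun s => f (y + s *: v)) (dot (gradient f (y + t *: v)) v).
Proof.
move=> df.
have dfv : derivable f (y + t *: v) v by exact: diff_derivable.
pose F (h : R) : R := h^-1 *: (f (h *: v + (y + t *: v)) - f (y + t *: v)).
have E : (fun h : R => h^-1 *: ((fun s => f (y + s *: v)) (h *: 1 + t)
      - f (y + t *: v))) = F.
  apply/funext => h; rewrite /F; congr (_ *: (f _ - _)).
  by rewrite scalerDl /GRing.scale/= mulr1 addrCA.
apply: DeriveDef.
  by rewrite /derivable E; exact: dfv.
have <- : 'D_v f (y + t *: v) = dot (gradient f (y + t *: v)) v.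
  by rewrite deriveE// diff_gradient.
have -> : 'D_v f (y + t *: v) = lim (F @ 0^') by [].
by rewrite /derive E.
Qed.

Lemma smooth_upper f L y v : smooth L f ->
  f v <= f y + dot (gradient f y) (v - y) + L / 2 * enorm (v - y) ^+ 2.
Proof.
move=> [df Lf].
have := @quadratic_upper_bound R (fun s => f (y + s *: (v - y)))
  (fun s => dot (gradient f (y + s *: (v - y))) (v - y))
  (L * enorm (v - y) ^+ 2) (fun t => is_derive_line y (v - y) t df).
rewrite scale1r scale0r addr0 subrKC => H.
rewrite (mulrAC L); apply: H => t t0.
rewrite -dotNl -dotDl (le_trans (dot_le_enorm _ _))//.
rewrite (_ : L * _ * t = L * enorm (y + t *: (v - y) - y) * enorm (v - y)).
  by rewrite ler_wpM2r ?enorm_ge0.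
by rewrite addrAC subrr add0r enormZ//; ring.
Qed.

Lemma smooth_lower f L y v : smooth L f ->
  f y + dot (gradient f y) (v - y) - L / 2 * enorm (v - y) ^+ 2 <= f v.
Proof.
move=> [df Lf].
have := @quadratic_upper_bound R (fun s => - f (y + s *: (v - y)))
  (fun s => - dot (gradient f (y + s *: (v - y))) (v - y))
  (L * enorm (v - y) ^+ 2) (fun t => is_deriveN (is_derive_line y (v - y) t df)).
rewrite scale1r scale0r addr0 subrKC => H.
suff : - f v <= - f y - dot (gradient f y) (v - y) + L * enorm (v - y) ^+ 2 / 2.
  by rewrite (mulrAC L); lra.
apply: H => t t0.
rewrite opprK addrC -dotNl -dotDl (le_trans (dot_le_enorm _ _))//.
rewrite (_ : L * _ * t = L * enorm (y - (y + t *: (v - y))) * enorm (v - y)).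
  by rewrite ler_wpM2r ?enorm_ge0.
by rewrite opprD addrA subrr add0r enormN enormZ//; ring.
Qed.

(** At the point [y + t (v - y)], strong convexity bounds [f] from above and smoothness bounds it
    from below by its linear model up to [O(t^2)]; divide by [t] and let it vanish. With [mu = 0]
    this also serves the convex function [h]. *)
Lemma strongly_convex_gradient f L mu y v : smooth L f ->
  strongly_convex mu f ->
  f y + dot (gradient f y) (v - y) + mu / 2 * enorm (v - y) ^+ 2 <= f v.
Proof.
move=> fL fmu.
suff : dot (gradient f y) (v - y) + mu / 2 * enorm (v - y) ^+ 2 <= f v - f y.
  by lra.
apply: (le_lim_small (C := (L + mu) / 2 * enorm (v - y) ^+ 2) ltr01) => t t0 t1.
have := fmu v y t (ltW t0) (ltW t1).
have := smooth_lower y (t *: v + (1 - t) *: y) fL.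
have -> : t *: v + (1 - t) *: y - y = t *: (v - y).
  by apply/rowP => i; rewrite !mxE; ring.
rewrite !enorm_sqr dotZr !dotZl !dotZr => h1 h2.
rewrite -(ler_pM2l t0); have := le_trans h1 h2.
set D := dot (v - y) (v - y); set g := dot _ _ => h.
lra.
Qed.

End Gradient.

(** * Recursive inequalities *)

Section Sequences.
Context {R : realType}.
Implicit Types (E theta eta u : R^nat).

Lemma nneseries_pinfty_unbounded u (A : R) (N : nat) : (forall k, 0 <= u k) ->
  (\sum_(0 <= k <oo) (u k)%:E = +oo)%E ->
  exists j, A < \sum_(i < j) u (N + i)%N.
Proof.
move=> u0 uoo; apply: contrapT => /forallNP uA.
have : (\sum_(0 <= k <oo) (u k)%:E <= (\sum_(i < N) u i + A)%:E)%E.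
  apply: lime_le; first by apply: is_cvg_nneseries => k _ _; rewrite lee_fin.
  apply: nearW => M; rewrite sumEFin lee_fin.
  apply: (@le_trans _ _ (\sum_(0 <= i < N + M) u i)).
    rewrite (big_cat_nat (leq0n M) (leq_addl N M)) /= lerDl.
    by apply: sumr_ge0 => k _.
  rewrite (big_cat_nat (leq0n N) (leq_addr M N)) /= big_mkord lerD2l.
  rewrite -{1}(add0n N) big_addn addKn big_mkord leNgt; apply/negP.
  by under eq_bigr do rewrite addnC; exact: uA.
by rewrite uoo leye_eq.
Qed.

(** For [a_k = E_k / eta_k] and [r_k = (eta_k - eta_{k+1}) / eta_{k+1}] the recursion reads [a_{k+1}
    <= (1 - theta_k) (1 + r_k) a_k + r_k B], where [r_k = o(sqrt eta_k)]. Above the level [e], [a_k]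
    drops by at least [theta_k e / 2], which cannot go on forever as the [theta_k] have infinite
    sum; once below [e], it stays there. *)
Lemma perturbed_contraction_small E theta eta (B c e : R) :
  0 <= B -> 0 < c -> 0 < e ->
  (forall k, 0 < eta k) -> (forall k, eta k.+1 <= eta k) ->
  (forall k, c * Num.sqrt (eta k) <= theta k) -> (forall k, theta k <= 1) ->
  (forall k, (0 < k)%N ->
    E k.+1 <= (1 - theta k) * E k + (eta k - eta k.+1) * B) ->
  (\sum_(0 <= k <oo) (Num.sqrt (eta k))%:E = +oo)%E ->
  (eta k - eta k.+1) / (eta k.+1 * Num.sqrt (eta k)) @[k --> \oo] --> (0 : R) ->
  \forall k \near \oo, E k <= eta k * e.
Proof.
move=> B0 c0 e0 eta0 etaS ctheta theta1 step sumoo rto0.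
have s0 k : 0 < Num.sqrt (eta k) by rewrite sqrtr_gt0.
have Be0 : 0 < B + e by rewrite ltr_wpDl.
(* Chosen so that [r_k <= rho sqrt eta_k] yields [r_k (B + e) <= theta_k e / 4]. *)
pose rho := c * e / (4 * (B + e)).
have rho0 : 0 < rho by rewrite !(divr_gt0, mulr_gt0).
pose r k := (eta k - eta k.+1) / eta k.+1.
have [N _ HN] : \forall k \near \oo, r k <= rho * Num.sqrt (eta k).
  move/cvgrPdist_lt : rto0 => /(_ rho rho0); apply: filterS => k.
  rewrite sub0r normrN => /ltW/(le_trans (ler_norm _)).
  by rewrite invfM mulrA ler_pdivrMr.
have theta0 k : 0 <= theta k by rewrite (le_trans _ (ctheta k))// mulr_ge0// ltW.
have rr k : (N <= k)%N -> r k * (B + e) <= theta k * e / 4.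
  move=> Nk; have /ler_wpM2r -/(_ (B + e) (ltW Be0)) /le_trans := HN _ Nk; apply.
  have -> : rho * Num.sqrt (eta k) * (B + e) = c * Num.sqrt (eta k) * e / 4.
    by rewrite /rho; field; rewrite lt0r_neq0.
  by rewrite ler_pM2r ?invr_gt0// ler_pM2r.
pose a k := E k / eta k.
have Ea k : E k = a k * eta k by rewrite /a divfK// gt_eqF.
have astep k : (0 < k)%N -> a k.+1 <= (1 - theta k) * ((1 + r k) * a k) + r k * B.
  move=> k0; rewrite /a ler_pdivrMr//; apply: (le_trans (step k k0)).
  rewrite le_eqVlt; apply/orP; left; apply/eqP; rewrite /r; field.
  by rewrite !gt_eqF.
have r0 k : 0 <= r k by rewrite divr_ge0 ?subr_ge0// ltW.
have stay k : (0 < k)%N -> (N <= k)%N -> a k <= e -> a k.+1 <= e.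
  move=> k0 Nk ake; apply: (le_trans (astep k k0)).
  have h1 : (1 + r k) * a k <= (1 + r k) * e by rewrite ler_wpM2l// addr_ge0.
  have h2 : (1 - theta k) * ((1 + r k) * a k) <= (1 - theta k) * ((1 + r k) * e).
    by rewrite ler_wpM2l// subr_ge0.
  have := rr k Nk; have := theta0 k; have := r0 k.
  move: h2; set t := theta k; set q := r k => h2 q0 t0 h3.
  have : 0 <= t * (q * e) by rewrite mulr_ge0// mulr_ge0// ltW.
  have : 0 <= t * e by rewrite mulr_ge0// ltW.
  lra.
have move k : (0 < k)%N -> (N <= k)%N -> e < a k -> a k.+1 <= a k - theta k * e / 2.
  move=> k0 Nk ake; apply: (le_trans (astep k k0)).
  have := rr k Nk; have := theta0 k; have := r0 k.
  set t := theta k; set q := r k => q0 t0 h3.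
  have h5 : 0 <= t * (a k - e) by rewrite mulr_ge0// subr_ge0 ltW.
  have q4 : q <= t / 4.
    rewrite -(ler_pM2r e0); apply: le_trans (_ : q * (B + e) <= _); last by lra.
    by rewrite ler_wpM2l// lerDr.
  have : q * B <= t * e / 4.
    by apply: le_trans h3; rewrite ler_wpM2l// lerDl ltW.
  have ak0 : 0 <= a k by rewrite ltW// (lt_trans e0).
  have : 0 <= t * (q * a k) by rewrite mulr_ge0// mulr_ge0.
  have : q * a k <= t / 4 * a k by rewrite ler_wpM2r.
  have : 0 <= t * e by rewrite mulr_ge0// ltW.
  lra.
have [k1 [k10 Nk1 ak1]] : exists k1, [/\ (0 < k1)%N, (N <= k1)%N & a k1 <= e].
  apply: contrapT => /forallNP H.
  have big k : (0 < k)%N -> (N <= k)%N -> e < a k.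
    by move=> k0 Nk; rewrite ltNge; apply/negP => ?; apply: (H k).
  have [j Hj] := nneseries_pinfty_unbounded (2 * a N.+1 / (c * e)) N.+1
    (fun k => ltW (s0 k)) sumoo.
  have : a (N.+1 + j)%N <= a N.+1 - c * e / 2 * \sum_(i < j) Num.sqrt (eta (N.+1 + i)%N).
    elim: {Hj}j => [|j IH]; first by rewrite big_ord0 addn0 mulr0 subr0.
    have [h1 h2] : (0 < N.+1 + j)%N /\ (N <= N.+1 + j)%N.
      by rewrite addSn; split=> //; rewrite leqW// leq_addr.
    rewrite big_ord_recr/= mulrDr opprD addrA addnS.
    apply: (le_trans (move _ h1 h2 (big _ h1 h2))).
    rewrite lerB//.
    rewrite mulrAC ler_pM2r ?invr_gt0// mulrAC ler_pM2r//.
  move: Hj; rewrite ltr_pdivrMr ?mulr_gt0// => Hj.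
  have := big (N.+1 + j)%N isT (leqW (leq_addr _ _)).
  by nra.
exists k1 => // k /= k1k; rewrite (Ea k) (mulrC (a k)).
rewrite ler_pM2l//.
rewrite -(subnKC k1k); elim: (k - k1)%N => [|i IH]; first by rewrite addn0.
by rewrite addnS stay// ?(leq_trans k10)// ?(leq_trans Nk1)// leq_addr.
Qed.

(** Bernoulli's inequality for the exponent [- q]: after factoring out [s], it follows from
    [ln (1 + z) <= z] and [exp z >= 1 + z]. *)
Lemma powR_shift_ge (s q : R) : 0 < s -> 0 <= q ->
  s `^ (- q) * (1 - q / s) <= (s + 1) `^ (- q).
Proof.
move=> s0 q0; have is0 : 0 < s^-1 by rewrite invr_gt0.
have -> : s + 1 = s * (1 + s^-1) by rewrite mulrDr mulr1 divff ?gt_eqF.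
rewrite powRM ?addr_ge0 ?(ltW s0) ?(ltW is0)// ler_pM2l ?powR_gt0//.
rewrite /powR gt_eqF ?addr_gt0//; apply: le_trans (expR_ge1Dx _).
rewrite lerD2l mulNr lerN2 ler_wpM2l// le_ln1Dx// (lt_trans _ is0)//.
Qed.

(** Induction on the bound itself, with [s = k + 1]. As [b < 1], half of the contraction [c s^-b]
    eventually pays for the growth [D / s] and for the loss [q / s] in passing from [s^-q] to
    [(s + 1)^-q]; the other half pays for the source term. Only upper bounds on [E] occur, so its
    sign is free. *)
Lemma power_recursion E theta (b q c C D : R) :
  b < 1 -> 0 < q -> 0 < c -> 0 <= C -> 0 <= D ->
  (forall k, c * k.+1%:R `^ (- b) <= theta k) -> (forall k, theta k <= 1) ->
  (forall k, (0 < k)%N ->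
    E k.+1 <= (1 + D / k.+1%:R) * ((1 - theta k) * E k)
              + C * k.+1%:R `^ (- (q + b))) ->
  exists2 B, 0 < B & forall k, (0 < k)%N -> E k <= B * k.+1%:R `^ (- q).
Proof.
move=> b1 q0 c0 C0 D0 ctheta theta1 step.
have s0 k : 0 < k.+1%:R :> R by rewrite ltr0n.
have p0 k x : 0 < k.+1%:R `^ x :> R by rewrite powR_gt0.
have [N HN] : exists N : nat, forall k, (N <= k)%N ->
    (D + q) / k.+1%:R <= c / 2 * k.+1%:R `^ (- b).
  pose z := 2 * (D + q) / c; pose w := z `^ (1 - b)^-1.
  have z0 : 0 <= z by rewrite divr_ge0 ?mulr_ge0 ?addr_ge0// ltW.
  exists (Num.bound w) => k wk.
  have wk1 : w <= k.+1%:R.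
    by rewrite ltW// (lt_le_trans (archi_boundP (powR_ge0 _ _)))// ler_nat leqW.
  have : z <= k.+1%:R `^ (1 - b).
    have -> : z = w `^ (1 - b).
      by rewrite -powRrM mulVf ?powRr1// subr_eq0 gt_eqF.
    by apply: ge0_ler_powR => //; rewrite ?nnegrE ?powR_ge0// subr_ge0 ltW.
  rewrite powRD ?pnatr_eq0 ?implybT// powRr1 ?ler0n// /z ler_pdivrMr// => h.
  by rewrite ler_pdivrMr//; lra.
have N1 : (0 < N.+1)%N by [].
(* The first summand gives [C <= B c / 2] for the inductive step, the sum covers the indices up to
   [N + 1], and the last one makes [B] positive. *)
pose B := 2 * C / c + \sum_(i < N.+2) `|E i| * i.+1%:R `^ q + 1.
have S0 : 0 <= \sum_(i < N.+2) `|E i| * i.+1%:R `^ q.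
  by apply: sumr_ge0 => i _; rewrite mulr_ge0// powR_ge0.
have C0' : 0 <= 2 * C / c by rewrite divr_ge0 ?mulr_ge0// ltW.
have B0 : 0 < B by rewrite ltr_wpDl// addr_ge0.
exists B => //.
have small k : (k < N.+2)%N -> E k <= B * k.+1%:R `^ (- q).
  move=> kN; rewrite powRN ler_pdivlMr//.
  apply: (@le_trans _ _ (`|E k| * k.+1%:R `^ q)).
    by rewrite ler_pM2r// ler_norm.
  apply: (@le_trans _ _ (\sum_(i < N.+2) `|E i| * i.+1%:R `^ q)).
    rewrite (bigD1 (Ordinal kN))//= lerDl.
    by apply: sumr_ge0 => i _; rewrite mulr_ge0// powR_ge0.
  by rewrite /B addrAC lerDr addr_ge0.
have large i : E (N.+1 + i)%N <= B * (N.+1 + i).+1%:R `^ (- q).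
  elim: i => [|i IH]; first by rewrite addn0 small.
  move: IH; rewrite addnS; set k := (N.+1 + i)%N => IH.
  have k0 : (0 < k)%N by [].
  have Nk : (N <= k)%N by rewrite /k addSn leqW// leq_addr.
  apply: (le_trans (step k k0)).
  have := powR_shift_ge (s0 k) (ltW q0); rewrite natr1 => /(ler_wpM2l (ltW B0)).
  move=> /(le_trans _); apply.
  have := HN k Nk; have := ctheta k; have := theta1 k.
  rewrite opprD powRD; last by rewrite pnatr_eq0 implybT.
  move: IH (p0 k (- q)) (p0 k (- b)) (s0 k).
  set s := k.+1%:R; set P := s `^ (- q); set Q := s `^ (- b); set t := theta k.
  rewrite [(D + q) / s]mulrDl; set d := D / s; set g := q / s.
  move=> IH P0 Q0 ss0 t1 ct h.
  have d0 : 0 <= d by rewrite divr_ge0// ltW.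
  have t0 : 0 <= t by rewrite (le_trans _ ct)// mulr_ge0// ltW.
  have CB : C <= B * c / 2.
    have : 2 * C / c <= B by rewrite /B -addrA lerDl addr_ge0.
    by rewrite ler_pdivrMr// => ?; lra.
  have h1 : (1 + d) * ((1 - t) * E k) <= (1 + d) * ((1 - t) * (B * P)).
    by rewrite ler_wpM2l ?addr_ge0// ler_wpM2l// subr_ge0.
  have h2 : (1 + d) * (1 - t) * (B * P) <= (1 - c * Q + d) * (B * P).
    rewrite ler_wpM2r ?mulr_ge0 ?(ltW B0) ?(ltW P0)//.
    have : 0 <= d * t by rewrite mulr_ge0.
    by nra.
  have h3 : (c / 2 * Q) * (B * P) <= (c * Q - (d + g)) * (B * P).
    by rewrite ler_wpM2r ?mulr_ge0 ?(ltW B0) ?(ltW P0)//; lra.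
  have h4 : C * (P * Q) <= B * c / 2 * (P * Q).
    by rewrite ler_wpM2r// mulr_ge0 ?ltW.
  lra.
move=> k k0; have [/small//|] := ltnP k N.+2.
by move=> /ltnW/subnKC <-; exact: large.
Qed.

End Sequences.

(** * Convexity and proximal steps *)

Section ConvexOn.
Context {R : realType} {n : nat}.
Implicit Types (C X : set 'rV[R]_n) (F W : 'rV[R]_n -> R) (x u v w s : 'rV[R]_n).

(** Real-valued form of convexity for an extended-valued function with domain [C]: the convexity of
    [C] is part of the conclusion, and values of [F] off [C] are irrelevant. [mu = 0] is plain
    convexity. *)
Definition strongly_convex_on (mu : R) C F : Prop :=
  forall u v (t : R), C u -> C v -> 0 <= t -> t <= 1 ->
    C (t *: u + (1 - t) *: v) /\
    F (t *: u + (1 - t) *: v) <=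
    t * F u + (1 - t) * F v - mu / 2 * t * (1 - t) * enorm (u - v) ^+ 2.

(** On each axis through [x], convexity bounds [F] by its values at two end points. Coordinates are
    then added one at a time: a sum of displacements is the midpoint of one doubled axis
    displacement and the doubled rest, so the admissible radius is halved at each stage. *)
Lemma convex_on_locally_bounded C F x : strongly_convex_on 0 C F -> C° x ->
  exists2 r : R, 0 < r & exists U, forall w, `|w - x| <= r -> C w /\ F w <= U.
Proof.
move=> FC; rewrite /interior/= -nbhs_ballE => -[r0 /= r00 Cr0].
have conv u v (t : R) : C u -> C v -> 0 <= t -> t <= 1 ->
    C (t *: u + (1 - t) *: v) /\ F (t *: u + (1 - t) *: v) <= t * F u + (1 - t) * F v.
  by move=> Cu Cv ht0 ht1; have := FC u v t Cu Cv ht0 ht1; rewrite !mul0r subr0.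
have Cball v : `|v| < r0 -> C (x + v).
  by move=> vr; apply: Cr0; rewrite -ball_normE /ball_/= opprD addNKr normrN.
pose r1 := r0 / 2.
have r10 : 0 < r1 by rewrite divr_gt0.
have r1lt : r1 < r0 by rewrite ltr_pdivrMr// ltr_pMr// ltr1n.
pose e (i : 'I_n) : 'rV[R]_n := delta_mx 0 i.
have Ce i (c : R) : `|c| <= r1 -> C (x + c *: e i).
  move=> cr; apply: Cball; apply: le_lt_trans r1lt.
  rewrite [`|_|]mx_normrE; apply/bigmax_leP; split => [|[j k] _] /=; first exact: ltW.
  rewrite !mxE; case: (_ && _); rewrite ?mulr1// mulr0 normr0; exact: ltW.
pose U i := F (x + r1 *: e i) + F (x + (- r1) *: e i) + `|F (x + r1 *: e i)|
   + `|F (x + (- r1) *: e i)|.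
have Ue i (c : R) : `|c| <= r1 -> F (x + c *: e i) <= U i.
  rewrite ler_norml => /andP[c1 c2].
  pose t := (c + r1) / (2 * r1).
  have t0 : 0 <= t by rewrite divr_ge0 ?mulr_ge0 ?(ltW r10)//; lra.
  have t1 : t <= 1 by rewrite ler_pdivrMr ?mulr_gt0//; lra.
  have := (conv (x + r1 *: e i) (x + (- r1) *: e i) t (Ce _ _ _) (Ce _ _ _) t0 t1).2.
  rewrite normrN ger0_norm ?(ltW r10)// => /(_ (lexx _) (lexx _)).
  have -> : t *: (x + r1 *: e i) + (1 - t) *: (x + - r1 *: e i) = x + c *: e i.
    by apply/rowP => j; rewrite !mxE /t; field; rewrite gt_eqF.
  move=> /le_trans; apply; rewrite /U.
  set A := F _; set B := F _.
  have := ler_norm A; have := ler_norm B; have := ler_norm (- A); have := ler_norm (- B).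
  rewrite !normrN; nra.
have H (l : seq 'I_n) : exists2 r : R, 0 < r & exists U', forall c : 'I_n -> R,
    (forall i, `|c i| <= r) ->
    C (x + \sum_(i <- l) c i *: e i) /\ F (x + \sum_(i <- l) c i *: e i) <= U'.
  elim: l => [|i l [r r_gt0 [U' IH]]].
    exists 1 => //; exists (F x) => c _; rewrite big_nil addr0; split=> //.
    by have := Cball 0; rewrite addr0 normr0; exact.
  exists (Num.min r r1 / 2); first by rewrite divr_gt0// lt_min r_gt0.
  exists (2^-1 * U i + (1 - 2^-1) * U') => c hc; rewrite big_cons.
  have hc2 j : `|2 * c j| <= Num.min r r1.
    by rewrite normrM ger0_norm// mulrC -ler_pdivlMr.
  have [hl1 hl2] : C (x + \sum_(i <- l) (2 * c i) *: e i) /\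
      F (x + \sum_(i <- l) (2 * c i) *: e i) <= U'.
    by apply: IH => j; apply: le_trans (hc2 j) _; rewrite ge_min lexx.
  have hi : `|2 * c i| <= r1 by apply: le_trans (hc2 i) _; rewrite ge_min lexx orbT.
  have hf0 : 0 <= 2^-1 :> R by rewrite invr_ge0.
  have hf1 : 2^-1 <= 1 :> R by rewrite invf_le1// ler1n.
  have := conv _ _ 2^-1 (Ce i _ hi) hl1 hf0 hf1.
  have -> : 2^-1 *: (x + (2 * c i) *: e i) +
       (1 - 2^-1) *: (x + \sum_(i <- l) (2 * c i) *: e i) =
      x + (c i *: e i + \sum_(j <- l) c j *: e j).
    have -> : \sum_(i <- l) (2 * c i) *: e i = 2 *: \sum_(j <- l) c j *: e j.
      by rewrite scaler_sumr; apply: eq_bigr => j _; rewrite scalerA.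
    by apply/rowP => j; rewrite !mxE; field.
  move=> [h1 h2]; split=> //; apply: (le_trans h2).
  apply: lerD; first by rewrite ler_wpM2l// Ue.
  by rewrite ler_wpM2l// subr_ge0.
have [r r_gt0 [U' HU]] := H (index_enum 'I_n); exists r => //; exists U' => w wr.
have -> : w = x + \sum_i (w - x) 0 i *: e i by rewrite -row_sum_delta addrC subrK.
apply: HU => i; apply: le_trans wr.
rewrite [`|w - x|]mx_normrE.
by apply: (@le_bigmax_cond _ _ _ _ (0, i) _ (fun ij => `|(w - x) ij.1 ij.2|)).
Qed.

Lemma exact_penalty C X F (mu r U : R) s : 0 <= mu -> 0 < r ->
  (forall w, `|w - s| <= r -> C w /\ F w <= U) ->
  strongly_convex_on mu C F ->
  (forall z (t : R), X z -> 0 <= t -> t <= 1 -> X (t *: z + (1 - t) *: s)) ->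
  (forall z, C z -> X z -> F s <= F z) ->
  exists2 M : R, 0 < M & forall u z (d : R), C u -> X z -> 0 < d ->
    enorm (u - z) <= d -> mu / 2 * enorm (u - s) ^+ 2 - M * d <= F u - F s.
Proof.
(* After shrinking towards [s] by a small factor [t], the point [zt] of [X] is *)
(* a convex combination of [ut] and of a point [w] of the ball where [F <= U], *)
(* the weight of [w] being of order [t * d]; compare with [F s <= F zt].       *)
move=> mu0 r0 FU FC Xs Fmin.
have [Cs sU] : C s /\ F s <= U by apply: FU; rewrite subrr normr0 ltW.
exists (2 / r * (U - F s) + 1).
  by rewrite ltr_wpDl// mulr_ge0 ?divr_ge0 ?subr_ge0// ltW.
move=> u z d Cu Xz d0 uzd.
have q0 : 0 < `|z - s| + r by rewrite ltr_wpDl.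
(* For [t < t0] the point [zt] is within [r / 2] of [s], which leaves room [r / 2] for the
   displacement from [zt] to [w]. *)
pose t0 := Num.min 1 (r / 2 / (`|z - s| + r)).
have t00 : 0 < t0 by rewrite lt_min ltr01 !divr_gt0.
apply: (le_lim_small (C := mu / 2 * enorm (u - s) ^+ 2) t00) => t t_gt0.
rewrite lt_min => /andP[t1 tr].
pose zt := t *: z + (1 - t) *: s; pose ut := t *: u + (1 - t) *: s.
(* [sg] is determined by [(1 + sg) zt = ut + sg w], since [zt - ut = t (z - u)]. *)
pose sg := 2 * t * d / r; pose w := zt + (r / (2 * d)) *: (z - u).
have sg0 : 0 < sg by rewrite divr_gt0// !mulr_gt0.
have [Cw wU] : C w /\ F w <= U.
  apply: FU.
  have -> : w - s = t *: (z - s) + (r / (2 * d)) *: (z - u).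
    by apply/rowP => i; rewrite !mxE; ring.
  have c0 : 0 <= r / (2 * d) by rewrite divr_ge0 ?mulr_ge0 ?(ltW r0) ?(ltW d0).
  apply: (le_trans (ler_normD _ _)).
  rewrite (normrZ t) (normrZ (r / (2 * d))) (ger0_norm (ltW t_gt0)) (ger0_norm c0).
  have h1 : t * `|z - s| <= r / 2.
    apply: (@le_trans _ _ (t * (`|z - s| + r))); first by rewrite ler_pM2l// lerDl ltW.
    by rewrite -ler_pdivlMr// ltW.
  have h2 : r / (2 * d) * `|z - u| <= r / (2 * d) * d.
    by rewrite ler_wpM2l// (le_trans _ uzd)// distrC norm_le_enorm.
  have h3 : r / (2 * d) * d = r / 2 by field; rewrite gt_eqF.
  by have := lerD h1 h2; rewrite h3 -splitr.
have [Cut utF] := FC u s t Cu Cs (ltW t_gt0) (ltW t1).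
have l0 : 0 <= (1 + sg)^-1 by rewrite invr_ge0 addr_ge0 ?ltW.
have l1 : (1 + sg)^-1 <= 1 by rewrite invf_le1 ?lerDl ?addr_gt0 ?(ltW sg0).
have := FC ut w (1 + sg)^-1 Cut Cw l0 l1.
have sg1 : 1 + sg != 0 by rewrite gt_eqF ?addr_gt0.
have -> : (1 + sg)^-1 *: ut + (1 - (1 + sg)^-1) *: w = zt.
  have -> : ut = zt - sg *: ((r / (2 * d)) *: (z - u)).
    by apply/rowP => i; rewrite !mxE /sg; field; rewrite !gt_eqF.
  rewrite /w; move: (zt) (sg) sg1 ((r / (2 * d)) *: (z - u)) => a b b1 c.
  by apply/rowP => i; rewrite !mxE; field.
move=> [Czt hzt]; have hs := Fmin zt Czt (Xs z t Xz (ltW t_gt0) (ltW t1)).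
have N0 : 0 <= mu / 2 * (1 + sg)^-1 * (1 - (1 + sg)^-1) * enorm (ut - w) ^+ 2.
  by rewrite mulr_ge0 ?sqr_ge0// mulr_ge0 ?subr_ge0// mulr_ge0// divr_ge0.
have sg_gt0 : 0 < 1 + sg by rewrite addr_gt0.
have h5 : (1 + sg) * F s <= F ut + sg * U.
  have -> : F ut + sg * U =
      (1 + sg) * ((1 + sg)^-1 * F ut + (1 - (1 + sg)^-1) * U) by field.
  rewrite ler_pM2l//; apply: (le_trans hs); apply: (le_trans hzt).
  apply: (@le_trans _ _ ((1 + sg)^-1 * F ut + (1 - (1 + sg)^-1) * F w)).
    by rewrite gerBl.
  by rewrite lerD2l ler_wpM2l// subr_ge0.
rewrite -(ler_pM2l t_gt0).
have h6 : sg * (U - F s) = t * (2 / r * (U - F s) * d).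
  by rewrite /sg; field; rewrite gt_eqF.
have h7 : 0 <= t * d by rewrite mulr_ge0 ?ltW.
set K := 2 / r * (U - F s) * d in h6 *.
rewrite -/ut in utF; move: utF; set N := enorm (u - s) ^+ 2.
have -> : (2 / r * (U - F s) + 1) * d = K + d by rewrite /K; ring.
lra.
Qed.

End ConvexOn.

(** * The accelerated proximal gradient step *)

Section Step.
Context {R : realType} {n : nat}.
Implicit Types (C X : set 'rV[R]_n) (F W : 'rV[R]_n -> R) (x u v w s : 'rV[R]_n).

(** The proximal objective is 1-strongly convex, so it grows quadratically from its minimizer:
    compare [w] with [t u + (1 - t) w] and let [t] tend to 0. *)
Lemma prox_three_point C W p w : strongly_convex_on 0 C W -> C w ->
  (forall u, C u -> W w + 2^-1 * enorm (w - p) ^+ 2 <= W u + 2^-1 * enorm (u - p) ^+ 2) ->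
  forall u, C u -> W w + 2^-1 * enorm (w - p) ^+ 2 + 2^-1 * enorm (u - w) ^+ 2 <=
    W u + 2^-1 * enorm (u - p) ^+ 2.
Proof.
move=> CW Cw wmin u Cu.
apply: (le_lim_small (C := 2^-1 * enorm (u - w) ^+ 2) ltr01) => t t0 t1.
have [Ct Wt] := CW u w t Cu Cw (ltW t0) (ltW t1).
rewrite -(ler_pM2l t0); have := wmin _ Ct.
have -> : t *: u + (1 - t) *: w - p = t *: (u - p) + (1 - t) *: (w - p).
  by apply/rowP => i; rewrite !mxE; ring.
have -> : u - w = (u - p) - (w - p) by rewrite opprB addrA subrK.
move: Wt; rewrite !mul0r subr0.
move: (u - p) (w - p) => a b; rewrite !enorm_sqr !dotE (dotC b a).
move: (dot _ _) (dot _ _) (dot _ _) (W _) (W _) (W _) => aa ab bb A B D.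
lra.
Qed.

(** Here [g] plays the gradient of [H] at [y]. Multiply the three-point inequality by [L] and expand
    the squares around [y]: the terms in [dot g g] cancel, and the linear ones turn into [H] through
    the upper model at [w] and the lower model at [u]. *)
Lemma prox_gradient_step C W (H : 'rV[R]_n -> R) (L mu : R) y g w : 0 < L ->
  strongly_convex_on 0 C W -> C w ->
  (forall u, C u ->
     L^-1 * W w + 2^-1 * enorm (w - (y - L^-1 *: g)) ^+ 2 <=
     L^-1 * W u + 2^-1 * enorm (u - (y - L^-1 *: g)) ^+ 2) ->
  (forall u, H y + dot g (u - y) + mu / 2 * enorm (u - y) ^+ 2 <= H u) ->
  H w <= H y + dot g (w - y) + L / 2 * enorm (w - y) ^+ 2 ->
  forall u, C u -> H w + W w + L / 2 * enorm (u - w) ^+ 2 <=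
    H u + W u + (L - mu) / 2 * enorm (u - y) ^+ 2.
Proof.
move=> L0 CW Cw wmin Hlow Hup u Cu.
have CLW : strongly_convex_on 0 C (fun u => L^-1 * W u).
  move=> a b t Ca Cb t0 t1; have [? h] := CW a b t Ca Cb t0 t1; split=> //.
  move: h; rewrite !mul0r !subr0 -(ler_pM2l (_ : 0 < L^-1)) ?invr_gt0// => h.
  by apply: (le_trans h); lra.
have := prox_three_point CLW Cw wmin Cu.
have E a : enorm (a - (y - L^-1 *: g)) ^+ 2 =
    enorm (a - y) ^+ 2 + 2 * L^-1 * dot g (a - y) + L^-1 ^+ 2 * dot g g.
  have -> : a - (y - L^-1 *: g) = (a - y) + L^-1 *: g.
    by rewrite opprB addrCA addrC.
  by move: (a - y) => b; rewrite !enorm_sqr !dotE (dotC g b); ring.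
rewrite !E -(ler_pM2l L0).
have Ln0 := lt0r_neq0 L0.
have scale (a b c e : R) :
    L * (L^-1 * a + 2^-1 * (b + 2 * L^-1 * c + L^-1 ^+ 2 * e)) =
    a + L / 2 * b + c + L^-1 / 2 * e by field.
rewrite mulrDr !scale; have := Hlow u; move: Hup.
move: (enorm _ ^+ 2) (enorm _ ^+ 2) (enorm _ ^+ 2) (dot g g) => a b c d.
move: (dot _ _) (dot _ _) (W _) (W _) (H _) (H _) (H _) => e f A A' B B' B''.
lra.
Qed.

(** The test point is [u = (1 - th) x + th s]. With [v' = x + th^-1 (w - x)] one has
    [u - w = - th (v' - s)], so [mu = L th^2] turns [L / 2 |u - w|^2] into the new distance term.
    What the estimate of [|u - y|^2] produces in [|x - s|^2] is cancelled exactly by the strong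
    convexity of [P] between [x] and [s]. *)
Lemma accelerated_step (P : 'rV[R]_n -> R) (L mu th : R) x v y w s :
  0 < th -> th <= 1 -> 0 < L -> mu = L * th ^+ 2 ->
  (1 + th) *: y = x + th *: v ->
  let u := (1 - th) *: x + th *: s in
  P w + L / 2 * enorm (u - w) ^+ 2 <= P u + (L - mu) / 2 * enorm (u - y) ^+ 2 ->
  P u <= (1 - th) * P x + th * P s - mu / 2 * (1 - th) * th * enorm (x - s) ^+ 2 ->
  P w - P s + mu / 2 * enorm (x + th^-1 *: (w - x) - s) ^+ 2 <=
    (1 - th) * (P x - P s + mu / 2 * enorm (v - s) ^+ 2).
Proof.
move=> th0 th1 L0 muE yE u hw hu.
have thn0 := lt0r_neq0 th0.
have th10 : 0 < 1 + th by rewrite addr_gt0.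
have -> : mu / 2 * enorm (x + th^-1 *: (w - x) - s) ^+ 2 = L / 2 * enorm (u - w) ^+ 2.
  have -> : u - w = (- th) *: (x + th^-1 *: (w - x) - s).
    by apply/rowP => i; rewrite !mxE; field.
  by rewrite !enorm_sqr dotZl dotZr muE; ring.
(* Convexity of the squared norm with weights [th / (1 + th)] and [1 / (1 + th)], applied to [x - s]
   and [v - s]. *)
have key : (1 + th) * enorm (u - y) ^+ 2 <=
    th ^+ 2 * (th * enorm (x - s) ^+ 2 + enorm (v - s) ^+ 2).
  have -> : u - y = (- th / (1 + th)) *: (th *: (x - s) + (v - s)).
    have -> : y = (1 + th)^-1 *: (x + th *: v).
      by rewrite -yE scalerA mulVf ?scale1r// lt0r_neq0.
    by apply/rowP => i; rewrite !mxE; field; rewrite lt0r_neq0.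
  move: (x - s) (v - s) => p q; rewrite !enorm_sqr !dotE (dotC q p).
  have := dot_ge0 (p - q); rewrite !dotE (dotC q p).
  move: (dot _ _) (dot _ _) (dot _ _) => c b a h.
  rewrite (_ : (1 + th) * _ = th ^+ 2 * ((th ^+ 2 * a + 2 * th * b + c) / (1 + th))).
    rewrite ler_pM2l ?exprn_gt0// ler_pdivrMr//.
    have : 0 <= th * (a - b - (b - c)) by apply: mulr_ge0; lra.
    lra.
  by field; rewrite lt0r_neq0.
have : (L - mu) / 2 * enorm (u - y) ^+ 2 <=
    mu / 2 * (1 - th) * (th * enorm (x - s) ^+ 2 + enorm (v - s) ^+ 2).
  rewrite muE.
  have -> : (L - L * th ^+ 2) / 2 * enorm (u - y) ^+ 2 =
     (L / 2 * (1 - th)) * ((1 + th) * enorm (u - y) ^+ 2) by ring.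
  have -> : L * th ^+ 2 / 2 * (1 - th) * (th * enorm (x - s) ^+ 2 + enorm (v - s) ^+ 2)
    = (L / 2 * (1 - th)) * (th ^+ 2 * (th * enorm (x - s) ^+ 2 + enorm (v - s) ^+ 2)) by ring.
  by rewrite ler_wpM2l// mulr_ge0 ?subr_ge0// divr_ge0// ltW.
move: hw hu; move: (enorm _ ^+ 2) (enorm _ ^+ 2) (enorm _ ^+ 2) (enorm _ ^+ 2) => a b c d.
lra.
Qed.

End Step.

(** * Extended-valued composite functions and their real-valued restrictions *)

Section Composite.
Context {R : realType} {n : nat}.
Implicit Types (f h : 'rV[R]_n -> R) (w : 'rV[R]_n -> \bar R) (u z : 'rV[R]_n).

(* Meaningful only on [dom w], since [fine +oo = 0]. *)
Definition rcomposite f w u : R := f u + fine (w u).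

Lemma dom_fineK w u : proper_function w -> dom w u -> (fine (w u))%:E = w u.
Proof. by move=> [wNy _] wu; rewrite fineK// fin_numElt wNy. Qed.

Lemma compositeE f w u : proper_function w -> dom w u ->
  composite f w u = (rcomposite f w u)%:E.
Proof. by move=> wp wu; rewrite /composite -(dom_fineK wp wu). Qed.

Lemma composite_dom f w u : (composite f w u < +oo)%E -> dom w u.
Proof. by rewrite /composite /dom/=; case: (w u) => [r||] /=; rewrite ?ltry ?ltNyr. Qed.

Lemma argmin_compositeP f w z : proper_function w ->
  argmin setT (composite f w) z <->
  dom w z /\ forall u, dom w u -> rcomposite f w z <= rcomposite f w u.
Proof.
move=> wp; split=> [[_ zmin]|[wz zmin]].
  have wz : dom w z.
    have [u0 wu0] := wp.2; apply: (@composite_dom f).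
    by apply: (le_lt_trans (zmin u0 I)); rewrite compositeE// ltry.
  split=> // u wu; have := zmin u I.
  by rewrite !compositeE// lee_fin.
split=> // u _; rewrite (compositeE f wp wz).
have [wu|wu] := pselect (dom w u); first by rewrite compositeE// lee_fin zmin.
rewrite leNgt; apply/negP => H; apply: wu; apply: (@composite_dom f).
by apply: lt_trans H _; rewrite ltry.
Qed.

Lemma fine_convex_on w : proper_function w -> econvex_function w ->
  strongly_convex_on 0 (dom w) (fun u => fine (w u)).
Proof.
move=> wp wc u v t wu wv t0 t1; have := wc u v t t0 t1.
rewrite -(dom_fineK wp wu) -(dom_fineK wp wv) -!EFinM -EFinD => H.
have wt : dom w (t *: u + (1 - t) *: v) by apply: (le_lt_trans H); rewrite ltry.
split=> //; move: H; rewrite -(dom_fineK wp wt) lee_fin.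
by rewrite !mul0r subr0.
Qed.

Lemma rcomposite_convex_on (mu : R) f w : strongly_convex mu f ->
  proper_function w -> econvex_function w ->
  strongly_convex_on mu (dom w) (rcomposite f w).
Proof.
move=> fmu wp wc u v t wu wv t0 t1.
have [wt ht] := fine_convex_on wp wc wu wv t0 t1.
split=> //; have := fmu u v t t0 t1; move: ht.
rewrite /rcomposite !mul0r subr0; lra.
Qed.

Lemma convex_function_strongly_convex h : convex_function setT h ->
  strongly_convex 0 h.
Proof.
move=> hc u v t t0 t1; rewrite !mul0r subr0.
by have := hc (Itv01 t0 t1) u v (in_setT _) (in_setT _).
Qed.

(** The sublevel set is the preimage of the epigraph of [w] under the continuous map
    [u -> (u, c - f u)]. In this form lower semicontinuity passes to cluster points. *)
Lemma composite_sublevel_closed f w (c : R) : (forall u, differentiable f u) ->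
  proper_function w -> closed_function w ->
  closed [set u | (composite f w u <= c%:E)%E].
Proof.
move=> df wp wcl.
have -> : [set u | (composite f w u <= c%:E)%E] =
    (fun u => (u, c - f u)) @^-1` [set p : 'rV[R]_n * R | (w p.1 <= p.2%:E)%E].
  apply/seteqP; split=> u /=; rewrite /composite; case: (w u) => [r||].
  - by rewrite -EFinD !lee_fin; lra.
  - by rewrite addey// leye_eq.
  - by move=> _; rewrite leNye.
  - by rewrite -EFinD !lee_fin; lra.
  - by rewrite leye_eq.
  - by move=> _; rewrite addeNy leNye.
apply: preimage_closed => // u _.
have fu : c - f v @[v --> u] --> c - f u.
  have fc : f v @[v --> u] --> f u by exact: differentiable_continuous.
  exact: (@cvgB R R^o _ (nbhs u) _ (fun=> c) f c (f u) (cvg_cst c) fc).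
exact: (cvg_pair (@cvg_id _ (nbhs u)) fu).
Qed.

End Composite.

(** * The bilevel problem *)

Section Problem.
Context {R : realType} {n : nat}.
Context {f h : 'rV[R]_n -> R} {wf wh : 'rV[R]_n -> \bar R}.
Context {Lf muf Lh : R} {xs : 'rV[R]_n}.
Context (A : bilevel_assumptions f h wf wh Lf muf Lh xs).

Local Notation Fb := (rcomposite f wf).
Local Notation Hb := (rcomposite h wh).
Local Notation X := (argmin setT (composite h wh)).

Lemma solution_dom : dom wf xs /\ dom wh xs.
Proof.
split; first exact: interior_subset (solution_interior A).
have : [set xs] xs by [].
rewrite -(unique_solution A) => -[Xxs _].
exact: ((argmin_compositeP h xs (wh_proper A)).1 Xxs).1.
Qed.

Lemma solution_argmin : X xs.
Proof.
have : [set xs] xs by [].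
by rewrite -(unique_solution A) => -[].
Qed.

Lemma lower_gap_ge0 u : dom wh u -> Hb xs <= Hb u.
Proof. exact: ((argmin_compositeP h xs (wh_proper A)).1 solution_argmin).2. Qed.

Lemma upper_optimal z : dom wf z -> X z -> Fb xs <= Fb z.
Proof.
move=> wz Xz; have : [set xs] xs by [].
rewrite -(unique_solution A) => -[_ /(_ z Xz)].
by rewrite !compositeE ?lee_fin//; [exact: wf_proper A|exact: wf_proper A|exact: solution_dom.1].
Qed.

Lemma solution_unique p : dom wf p -> dom wh p -> Hb p <= Hb xs ->
  Fb p <= Fb xs -> p = xs.
Proof.
move=> wfp whp Hp Fp; suff : [set xs] p by [].
rewrite -(unique_solution A); split.
  apply/argmin_compositeP; first exact: wh_proper A.
  by split=> // u whu; apply: (le_trans Hp); exact: lower_gap_ge0.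
move=> z Xz; rewrite (compositeE f (wf_proper A) wfp).
have [wz|wz] := pselect (dom wf z); last first.
  rewrite leNgt; apply/negP => H; apply: wz; apply: (@composite_dom _ _ f).
  by apply: lt_trans H _; rewrite ltry.
rewrite (compositeE f (wf_proper A) wz) lee_fin.
by apply: (le_trans Fp); exact: upper_optimal.
Qed.

Lemma upper_lower_bound : exists2 B : R, 0 <= B &
  forall u, dom wf u -> - B <= Fb u - Fb xs.
Proof.
have := upper_bounded_below A; set I := ereal_inf _ => INy.
have Ile u : dom wf u -> (I <= (Fb u)%:E)%E.
  move=> wu; rewrite -(compositeE f (wf_proper A) wu).
  by apply: ereal_inf_lbound; exists u.
have Ixs := Ile _ solution_dom.1.
move: INy Ile Ixs; case: I => [r _ Ile Ixs||]//.
exists (Fb xs - r); first by rewrite subr_ge0 -lee_fin.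
by move=> u /Ile; rewrite lee_fin; lra.
Qed.

Lemma argmin_convex z (t : R) : X z -> 0 <= t -> t <= 1 ->
  X (t *: z + (1 - t) *: xs).
Proof.
move=> Xz t0 t1; have [whz hz] := (argmin_compositeP h z (wh_proper A)).1 Xz.
have [ht1 ht2] := rcomposite_convex_on
  (convex_function_strongly_convex (h_convex A)) (wh_proper A) (wh_convex A)
  whz solution_dom.2 t0 t1.
apply/argmin_compositeP; first exact: wh_proper A.
split=> // u whu; apply: (le_trans ht2); rewrite !mul0r subr0.
have h1 := hz u whu; have h2 := lower_gap_ge0 whu.
rewrite (_ : Hb u = t * Hb u + (1 - t) * Hb u); last by ring.
by apply: lerD; apply: ler_wpM2l => //; rewrite subr_ge0.
Qed.

(** The interiority of [xs] enters here: it makes [Fb] bounded above on a ball around [xs], as the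
    exact penalty bound requires. *)
Lemma upper_growth : exists2 M : R, 0 < M & forall u z (d : R),
  dom wf u -> X z -> 0 < d -> enorm (u - z) <= d ->
  muf / 2 * enorm (u - xs) ^+ 2 - M * d <= Fb u - Fb xs.
Proof.
have sc := rcomposite_convex_on (f_strongly_convex A) (wf_proper A) (wf_convex A).
have muf0 := muf_gt0 A.
have sc0 : strongly_convex_on 0 (dom wf) Fb.
  move=> u v t wu wv t0 t1; have [? /le_trans H] := sc u v t wu wv t0 t1.
  split=> //; apply: H; rewrite !mul0r subr0 gerBl.
  apply: mulr_ge0 (sqr_ge0 _); apply: mulr_ge0; last by rewrite subr_ge0.
  by apply: mulr_ge0 => //; rewrite divr_ge0 ?(ltW muf0).
have [r r0 [U HU]] := convex_on_locally_bounded sc0 (solution_interior A).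
exact: (exact_penalty (ltW muf0) r0 HU sc argmin_convex upper_optimal).
Qed.

Lemma lower_inf : ereal_inf (range (composite h wh)) = (Hb xs)%:E.
Proof.
have [_ xmin] := solution_argmin; have wxs := solution_dom.2.
rewrite -(compositeE h (wh_proper A) wxs).
apply/eqP; rewrite eq_le; apply/andP; split.
  by apply: ereal_inf_lbound; exists xs.
by apply: le_ereal_inf_tmp => _ [u _ <-]; exact: xmin.
Qed.

Lemma upper_growth_dist : exists2 M : R, 0 < M & forall u, dom wf u ->
  muf / 2 * enorm (u - xs) ^+ 2 - M * dist u X <= Fb u - Fb xs.
Proof.
have [M M0 HM] := upper_growth; exists M => // u wu.
set S := [set enorm (u - z) | z in X].
have S0 : S !=set0 by exists (enorm (u - xs)), xs => //; exact: solution_argmin.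
apply/ler_addgt0Pl => e e0.
have [_ [z Xz <-] zd] : exists2 y : R, S y & y < inf S + e / M.
  by apply: inf_lt => //; rewrite ltrDl divr_gt0.
have d0 : 0 < inf S + e / M by apply: le_lt_trans zd; exact: enorm_ge0.
have := HM u z _ wu Xz d0 (ltW zd).
rewrite mulrDr (mulrC M (e / M)) divfK ?gt_eqF// /dist -/S; lra.
Qed.

Lemma dist_ge0 u : 0 <= dist u X.
Proof.
apply: lb_le_inf; last by move=> _ [z _ <-]; exact: enorm_ge0.
by exists (enorm (u - xs)), xs => //; exact: solution_argmin.
Qed.

(** * Energy decay along the iterates and convergence *)

Section Iterates.
Context {eta : R^nat} {x y : nat -> 'rV[R]_n}.
Context (Lfmuf : muf <= Lf) (eta0 : forall k, 0 < eta k).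
Context (etaS : forall k, eta k.+1 <= eta k).
Context (xy : IR_VFISTA f h wf wh Lf muf Lh eta x y).

Local Notation kap := (kappa Lf muf Lh eta).
Local Notation th := (fun k => (Num.sqrt (kap k))^-1).

Lemma Lk_gt0 k : 0 < Lh + eta k * Lf.
Proof.
have Lf0 : 0 < Lf := lt_le_trans (muf_gt0 A) Lfmuf.
by rewrite addr_gt0 ?(Lh_gt0 A) ?mulr_gt0.
Qed.

(** The proximal objective is finite at [xs], hence at its minimizer; as [wf] and [wh] never take
    [-oo] and the weights are positive, both are finite there. *)
Lemma iterates_dom k : dom wf (x k.+1) /\ dom wh (x k.+1).
Proof.
have [_ /(_ k) [_ /(_ xs I) xmin] _] := xy; move: xmin => /=.
set p := (X in enorm (xs - X)); move=> xmin.
have g0 : 0 < gamma Lf Lh eta k.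
  by rewrite invr_gt0 Lk_gt0.
have : ((gamma Lf Lh eta k)%:E * (wh xs + (eta k)%:E * wf xs) +
   (2^-1 * enorm (xs - p) ^+ 2)%:E < +oo)%E.
  rewrite -(dom_fineK (wf_proper A) solution_dom.1).
  by rewrite -(dom_fineK (wh_proper A) solution_dom.2) ltry.
move: xmin => /le_lt_trans/[apply].
have := (wf_proper A).1 (x k.+1); have := (wh_proper A).1 (x k.+1).
rewrite /dom/=; case: (wf _) => [a||] //; case: (wh _) => [b||] // _ _.
- by rewrite addye// gt0_muley ?lte_fin// addye.
- by rewrite (gt0_muley (_ : 0 < (eta k)%:E)%E) ?lte_fin// addey// gt0_muley ?lte_fin// addye.
- by rewrite (gt0_muley (_ : 0 < (eta k)%:E)%E) ?lte_fin// addey// gt0_muley ?lte_fin// addye.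
Qed.

Lemma theta_gt0 k : 0 < th k.
Proof.
by rewrite invr_gt0 sqrtr_gt0 divr_gt0 ?Lk_gt0 ?mulr_gt0 ?(muf_gt0 A).
Qed.

Lemma theta_sqr k : eta k * muf = (Lh + eta k * Lf) * th k ^+ 2.
Proof.
have L0 := Lk_gt0 k.
have em0 : 0 < eta k * muf by rewrite mulr_gt0 ?(muf_gt0 A).
rewrite exprVn sqr_sqrtr; last by rewrite divr_ge0// ltW.
by rewrite /kappa; field; rewrite !gt_eqF ?(muf_gt0 A).
Qed.

Lemma theta_le1 k : th k <= 1.
Proof.
have L0 := Lk_gt0 k.
rewrite -(@ler_pXn2r _ 2) ?nnegrE ?(ltW (theta_gt0 k))// expr1n.
rewrite -(ler_pM2l L0) mulr1 -theta_sqr.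
apply: (@le_trans _ _ (eta k * Lf)); first by rewrite ler_pM2l.
by rewrite lerDr (ltW (Lh_gt0 A)).
Qed.

Lemma theta_lower k :
  Num.sqrt (muf / (Lh + eta 0%N * Lf)) * Num.sqrt (eta k) <= th k.
Proof.
have Lf0 : 0 < Lf := lt_le_trans (muf_gt0 A) Lfmuf.
have L0 := Lk_gt0.
have m0 : 0 <= muf / (Lh + eta 0%N * Lf) by rewrite divr_ge0 ?(ltW (muf_gt0 A)) ?(ltW (L0 _)).
rewrite -sqrtrM// -sqrtrV; last first.
  by rewrite divr_ge0 ?mulr_ge0 ?(ltW (L0 _)) ?(ltW (muf_gt0 A)) ?(ltW (eta0 _)).
rewrite ler_wsqrtr// /kappa invf_div (mulrC (eta k)) mulrAC.
rewrite ler_wpM2l ?mulr_ge0 ?(ltW (eta0 _)) ?(ltW (muf_gt0 A))//.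
rewrite lef_pV2 ?posrE// lerD2l ler_pM2r//.
by elim: k => // k; apply: le_trans.
Qed.

(* [x 0] may lie outside the domains, so the energy makes sense from [k = 1] on. *)
Lemma energy_step : exists2 V : R^nat, forall k, 0 <= V k &
  forall k, (0 < k)%N ->
    Hb (x k.+1) - Hb xs + eta k * (Fb (x k.+1) - Fb xs + V k.+1) <=
    (1 - th k) * (Hb (x k) - Hb xs + eta k * (Fb (x k) - Fb xs + V k)).
Proof.
(* Equivalently [v k = x k + (sqrt kap_{k-1} - 1) (x k - x k.-1)], whose coefficient is the
   numerator of the momentum; at [k = 0] it is just [x 0]. *)
pose v k := x k.-1 + Num.sqrt (kap k.-1) *: (x k - x k.-1).
exists (fun k => muf / 2 * enorm (v k - xs) ^+ 2).
  by move=> k; rewrite mulr_ge0 ?sqr_ge0// divr_ge0 ?(ltW (muf_gt0 A)).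
case=> // j _; set k := j.+1.
pose D := [set u | dom wf u /\ dom wh u].
pose W u := fine (wh u) + eta k * fine (wf u).
pose H u := h u + eta k * f u.
pose P u := H u + W u.
have PE u : P u = Hb u + eta k * Fb u by rewrite /P /H /W /rcomposite; ring.
pose L := Lh + eta k * Lf; have L0 : 0 < L := Lk_gt0 k.
have e0 := eta0 k; have m0 := muf_gt0 A.
have DW : strongly_convex_on 0 D W.
  move=> a b t [fa ha] [fb hb] t0 t1.
  have [f1 f2] := fine_convex_on (wf_proper A) (wf_convex A) fa fb t0 t1.
  have [h1 h2] := fine_convex_on (wh_proper A) (wh_convex A) ha hb t0 t1.
  split; first by split.
  have := ler_wpM2l (ltW e0) f2; move: h2; rewrite !mul0r !subr0 /W; lra.
have Dxs : D xs := solution_dom.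
have Dk : D (x k) := iterates_dom j.
have Dk1 : D (x k.+1) := iterates_dom k.
have WE u : D u -> ((gamma Lf Lh eta k)%:E * (wh u + (eta k)%:E * wf u))%E =
    (L^-1 * W u)%:E.
  by move=> [fu hu]; rewrite -(dom_fineK (wf_proper A) fu) -(dom_fineK (wh_proper A) hu).
pose g := gradient h (y k) + eta k *: gradient f (y k).
have step : forall u, D u -> P (x k.+1) + L / 2 * enorm (u - x k.+1) ^+ 2 <=
    P u + (L - eta k * muf) / 2 * enorm (u - y k) ^+ 2.
  apply: (prox_gradient_step (g := g) L0 DW Dk1).
  - move=> u Du; have [_ /(_ k) [_ /(_ u I) xmin] _] := xy; move: xmin => /=.
    by rewrite !WE// -!EFinD lee_fin.
  - move=> u.
    have hu := strongly_convex_gradient (y k) u (h_smooth A)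
      (convex_function_strongly_convex (h_convex A)).
    have fu := strongly_convex_gradient (y k) u (f_smooth A) (f_strongly_convex A).
    have {fu} := ler_wpM2l (ltW e0) fu; move: hu; rewrite /H /g dotDl dotZl.
    move: (enorm _ ^+ 2) (dot _ _) (dot _ _) (h u) (f u) (h _) (f _).
    move=> a b c p q r s; lra.
  - have hu := smooth_upper (y k) (x k.+1) (h_smooth A).
    have fu := smooth_upper (y k) (x k.+1) (f_smooth A).
    have {fu} := ler_wpM2l (ltW e0) fu; move: hu; rewrite /H /g dotDl dotZl /L.
    move: (enorm _ ^+ 2) (dot _ _) (dot _ _) (h (y k)) (f (y k)) (h _) (f _).
    move=> a b c p q r s; lra.
have t0 := theta_gt0 k; have t1 := theta_le1 k.
(* The denominator of the momentum coefficient is [sqrt kap_k + 1 = (1 + th k) / th k], which gives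
   exactly Nesterov's coupling of [x], [v] and [y]. *)
have vE : (1 + th k) *: y k = x k + th k *: v k.
  have [_ _ ->] := xy; rewrite /v /= -/k.
  have s1 : Num.sqrt (kap k) != 0 by rewrite gt_eqF// -invr_gt0.
  have s2 : Num.sqrt (kap k) + 1 != 0 by rewrite gt_eqF// addr_gt0// -invr_gt0.
  by apply/rowP => i; rewrite !mxE; field; rewrite s1.
have Du : D ((1 - th k) *: x k + th k *: xs) /\
    P ((1 - th k) *: x k + th k *: xs) <= (1 - th k) * P (x k) + th k * P xs
      - eta k * muf / 2 * (1 - th k) * th k * enorm (x k - xs) ^+ 2.
  have t0' : 0 <= 1 - th k by rewrite subr_ge0.
  have t1' : 1 - th k <= 1 by rewrite gerBl ltW.
  have [f1 f2] := rcomposite_convex_on (f_strongly_convex A) (wf_proper A)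
    (wf_convex A) Dk.1 Dxs.1 t0' t1'.
  have [h1 h2] := rcomposite_convex_on
    (convex_function_strongly_convex (h_convex A)) (wh_proper A) (wh_convex A)
    Dk.2 Dxs.2 t0' t1'.
  move: f1 f2 h1 h2; rewrite subKr => f1 f2 h1 h2; split=> //.
  rewrite !PE; move: h2; have := ler_wpM2l (ltW e0) f2; rewrite !mul0r subr0.
  move: (enorm _ ^+ 2) (Fb _) (Fb _) (Fb _) (Hb _) (Hb _) (Hb _) => a b c d p q r.
  lra.
have := accelerated_step t0 t1 L0 (theta_sqr k) vE (step _ Du.1) Du.2.
have -> : x k + (th k)^-1 *: (x k.+1 - x k) = v k.+1 by rewrite /v invrK.
by rewrite !PE /=; move: (enorm _ ^+ 2) (enorm _ ^+ 2) => a b; lra.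
Qed.

Lemma iterates_cvg :
  eta k @[k --> \oo] --> (0 : R) ->
  (\sum_(0 <= k <oo) (Num.sqrt (eta k))%:E = +oo)%E ->
  (eta k - eta k.+1) / (eta k.+1 * Num.sqrt (eta k)) @[k --> \oo] --> (0 : R) ->
  x k @[k --> \oo] --> xs.
Proof.
move=> eta_cvg0 sumoo rto0.
have [B B0 HB] := upper_lower_bound; have [V V0 step] := energy_step.
have idom k : (0 < k)%N -> dom wf (x k) /\ dom wh (x k).
  by case: k => // k _; exact: iterates_dom.
pose E k := Hb (x k) - Hb xs + eta k * (Fb (x k) - Fb xs + V k).
have c0 : 0 < Num.sqrt (muf / (Lh + eta 0%N * Lf)).
  by rewrite sqrtr_gt0 divr_gt0 ?(muf_gt0 A)// (Lk_gt0 0).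
have Estep k : (0 < k)%N -> E k.+1 <= (1 - th k) * E k + (eta k - eta k.+1) * B.
  move=> k0; have := step k k0; have := HB (x k.+1) (iterates_dom k).1.
  have := V0 k.+1; rewrite -/(E k) /E.
  move: (Fb _ - _) (V k.+1) (Hb (x k.+1) - _) => F v G v0 hF hE.
  have : (eta k - eta k.+1) * (- B) <= (eta k - eta k.+1) * (F + v).
    by apply: ler_wpM2l; [rewrite subr_ge0|lra].
  lra.
have small e : 0 < e -> \forall k \near \oo, E k <= eta k * e.
  move=> e0.
  exact: (perturbed_contraction_small B0 c0 e0 eta0 etaS theta_lower theta_le1
    Estep sumoo rto0).
have Fsmall e : 0 < e -> \forall k \near \oo, Fb (x k) - Fb xs <= e.
  move=> e0; near=> k.
  have k0 : (0 < k)%N by near: k; exact: nbhs_infty_gt.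
  have : E k <= eta k * e by near: k; exact: small.
  have := lower_gap_ge0 (idom k k0).2; rewrite /E -subr_ge0 => G0 H.
  rewrite -(ler_pM2l (eta0 k)); apply: le_trans H.
  have : 0 <= eta k * V k by rewrite mulr_ge0 ?(ltW (eta0 k)).
  lra.
have Gsmall e : 0 < e -> \forall k \near \oo, Hb (x k) - Hb xs <= e.
  move=> e0; near=> k.
  have k0 : (0 < k)%N by near: k; exact: nbhs_infty_gt.
  have : E k <= eta k * 1 by near: k; exact: small.
  have hk : eta k * (1 + B) <= e.
    rewrite -ler_pdivlMr; last by rewrite ltr_pwDl.
    apply/ltW; rewrite -[ltLHS]gtr0_norm// -normrN -[X in `|X|]add0r.
    near: k; move/cvgrPdist_lt : eta_cvg0; apply.
    by rewrite divr_gt0// ltr_pwDl.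
  move=> H; apply: le_trans hk; move: H; rewrite /E.
  have := HB _ (idom k k0).1; have : 0 <= eta k * V k by rewrite mulr_ge0 ?(ltW (eta0 k)).
  move=> h1; rewrite -(ler_pM2l (eta0 k)) => h2; lra.
have [M M0 HM] := upper_growth.
have m0 := muf_gt0 A.
(* With [N = |x_k - xs| >= 1], growth gives [muf / 2 N^2 <= M (N + 1) + 1 <= (2 M + 1) N]; the
   leading 1 covers [N <= 1]. *)
pose K := 1 + 2 * (2 * M + 1) / muf.
have K0 : 0 < K by rewrite ltr_pwDl// divr_ge0 ?(ltW m0)// mulr_ge0// addr_ge0// mulr_ge0// ltW.
pose S := closed_ball_ (fun u : 'rV[R]_n => `|u|) xs K.
have FS : \forall k \near \oo, S (x k).
  near=> k; rewrite /S /closed_ball_/= distrC; apply: (le_trans (norm_le_enorm _)).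
  have k0 : (0 < k)%N by near: k; exact: nbhs_infty_gt.
  have F1 : Fb (x k) - Fb xs <= 1 by near: k; exact: Fsmall.
  have N0 := enorm_ge0 (x k - xs).
  have := HM (x k) xs (enorm (x k - xs) + 1) (idom k k0).1 solution_argmin.
  move=> /(_ (ltr_wpDl N0 ltr01)); rewrite lerDl => /(_ ler01).
  move: N0 F1; set N := enorm _ => N0 F1 H.
  have [N1|/ltW N1] := leP N 1.
    by apply: (le_trans N1); rewrite lerDl divr_ge0 ?(ltW m0)// mulr_ge0// addr_ge0// mulr_ge0// ltW.
  apply: (@le_trans _ _ (2 * (2 * M + 1) / muf)); last by rewrite lerDr.
  rewrite ler_pdivlMr//.
  have Npos : 0 < N by apply: lt_le_trans N1.
  rewrite -(ler_pM2l Npos).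
  have : M <= M * N by rewrite ler_pMr.
  lra.
have cS : compact S.
  apply: bounded_closed_compact; last exact: closed_closed_ball_.
  exists (`|xs| + K); split; first exact: num_real.
  move=> r rK u; rewrite /S /closed_ball_/= => uS.
  rewrite ltW// (le_lt_trans _ rK)// -[u](subKr xs) (le_trans (ler_normB _ _))//.
  by rewrite lerD2l.
have limit_point p : cluster (x k @[k --> \oo]) p -> p = xs.
  rewrite clusterE => clp.
  have closedP (Q : set 'rV[R]_n) : closed Q -> (\forall k \near \oo, Q (x k)) -> Q p.
    by move=> Qc Qx; rewrite (closure_id Q).1//; exact: clp.
  have Fp e : 0 < e -> (composite f wf p <= (Fb xs + e)%:E)%E.
    move=> e0; apply: (closedP [set u | (composite f wf u <= (Fb xs + e)%:E)%E]).
      apply: composite_sublevel_closed; last exact: wf_closed A.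
        by case: (f_smooth A).
      exact: wf_proper A.
    near=> k; rewrite /= compositeE; [|exact: wf_proper A|].
      by rewrite lee_fin -lerBlDl; near: k; exact: Fsmall.
    by apply: (idom k _).1; near: k; exact: nbhs_infty_gt.
  have Hp e : 0 < e -> (composite h wh p <= (Hb xs + e)%:E)%E.
    move=> e0; apply: (closedP [set u | (composite h wh u <= (Hb xs + e)%:E)%E]).
      apply: composite_sublevel_closed; last exact: wh_closed A.
        by case: (h_smooth A).
      exact: wh_proper A.
    near=> k; rewrite /= compositeE; [|exact: wh_proper A|].
      by rewrite lee_fin -lerBlDl; near: k; exact: Gsmall.
    by apply: (idom k _).2; near: k; exact: nbhs_infty_gt.
  have wfp : dom wf p.
    by apply: (@composite_dom _ _ f); apply: le_lt_trans (Fp 1 ltr01) _; rewrite ltry.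
  have whp : dom wh p.
    by apply: (@composite_dom _ _ h); apply: le_lt_trans (Hp 1 ltr01) _; rewrite ltry.
  apply: solution_unique => //; apply/ler_addgt0Pr => e e0.
    by have := Hp e e0; rewrite (compositeE h (wh_proper A) whp) lee_fin.
  by have := Fp e e0; rewrite (compositeE f (wf_proper A) wfp) lee_fin.
have Sxs : nbhs xs S.
  apply/nbhs_ballP; exists K => // u; rewrite -ball_normE /ball_ /S /closed_ball_/=.
  exact: ltW.
apply: (compact_cluster_set1 (@norm_hausdorff R 'rV[R]_n) cS Sxs _ FS).
apply/seteqP; split=> [p /limit_point//|_ ->].
have [p [_ clp]] := cS (x k @[k --> \oo]) _ FS.
by rewrite -(limit_point p clp).
Unshelve. all: by end_near. Qed.

End Iterates.
End Problem.

(** * Power estimates and rates under weak sharpness *)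

Section Powers.
Context {R : realType}.

Lemma powRDgt0 (s p q : R) : 0 < s -> s `^ (p + q) = s `^ p * s `^ q.
Proof. by move=> s0; rewrite powRD// (gt_eqF s0) implybT. Qed.

Lemma ge_powRN (s t q : R) : 0 < s -> s <= t -> 0 <= q -> t `^ (- q) <= s `^ (- q).
Proof.
move=> s0 st q0; have t0 := lt_le_trans s0 st.
rewrite !powRN lef_pV2 ?posrE ?powR_gt0//.
by apply: ge0_ler_powR => //; rewrite nnegrE ltW.
Qed.

(** Young's inequality by cases: if the term in [d^m] does not already dominate, then
    [d^(m-1) <= 2 M e / al], and this bound on [d] is inserted on the left. The exponent of [e] is
    the conjugate [m / (m - 1)]. *)
Lemma powR_young (M al m : R) : 0 < M -> 0 < al -> 1 < m ->
  exists2 C : R, 0 <= C & forall d e : R, 0 <= d -> 0 < e ->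
    e * (M * d) <= al / 2 * d `^ m + C * e `^ (1 + (m - 1)^-1).
Proof.
move=> M0 al0 m1; have m10 : 0 < m - 1 by rewrite subr_gt0.
have z0 : 0 < 2 * M / al by rewrite divr_gt0// mulr_gt0.
exists (M * (2 * M / al) `^ (m - 1)^-1); first by rewrite mulr_ge0 ?powR_ge0 ?ltW.
move=> d e d0 e0.
have C0 : 0 <= M * (2 * M / al) `^ (m - 1)^-1 * e `^ (1 + (m - 1)^-1).
  by rewrite !mulr_ge0 ?powR_ge0 ?ltW.
have [h|h] := leP (e * (M * d)) (al / 2 * d `^ m); first lra.
have dm0 : 0 <= al / 2 * d `^ m by rewrite !mulr_ge0 ?powR_ge0 ?invr_ge0 ?ltW.
suff : e * (M * d) <= M * (2 * M / al) `^ (m - 1)^-1 * e `^ (1 + (m - 1)^-1) by lra.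
have dpos : 0 < d.
  rewrite lt_neqAle d0 andbT; apply/negP => /eqP d00.
  by move: h; rewrite -d00 powR0 ?gt_eqF ?(lt_trans ltr01)// !mulr0 ltxx.
have hd : d `^ (m - 1) <= 2 * M / al * e.
  move: h; rewrite -(mulr_powRB1 d0 (lt_trans ltr01 m1)).
  have -> : al / 2 * (d * d `^ (m - 1)) = d * (al / 2 * d `^ (m - 1)) by ring.
  have -> : e * (M * d) = d * (e * M) by ring.
  rewrite ltr_pM2l// => /ltW h.
  rewrite mulrAC ler_pdivlMr//; lra.
rewrite powRDgt0// powRr1 ?(ltW e0)//.
have -> : M * (2 * M / al) `^ (m - 1)^-1 * (e * e `^ (m - 1)^-1) =
    e * (M * ((2 * M / al) `^ (m - 1)^-1 * e `^ (m - 1)^-1)) by ring.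
rewrite -powRM ?(ltW z0) ?(ltW e0)// !ler_pM2l//.
have {1}-> : d = (d `^ (m - 1)) `^ (m - 1)^-1.
  by rewrite -powRrM divff ?gt_eqF// powRr1.
apply: ge0_ler_powR => //; rewrite ?nnegrE ?powR_ge0 ?invr_ge0 ?(ltW m10)//.
by rewrite mulr_ge0 ?(ltW z0) ?(ltW e0).
Qed.

End Powers.

Section Rates.
Context {R : realType} {n : nat}.
Context {f h : 'rV[R]_n -> R} {wf wh : 'rV[R]_n -> \bar R}.
Context {Lf muf Lh : R} {xs : 'rV[R]_n}.
Context (A : bilevel_assumptions f h wf wh Lf muf Lh xs).
Context {eta : R^nat} {x y : nat -> 'rV[R]_n}.
Context (Lfmuf : muf <= Lf) (eta0 : forall k, 0 < eta k).
Context (etaS : forall k, eta k.+1 <= eta k).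
Context (xy : IR_VFISTA f h wf wh Lf muf Lh eta x y).

Local Notation Fb := (rcomposite f wf).
Local Notation Hb := (rcomposite h wh).
Local Notation X := (argmin setT (composite h wh)).
Local Notation th := (fun k => (Num.sqrt (kappa Lf muf Lh eta k))^-1).

Lemma rates (al m a : R) : 1 < m -> 0 < a -> a < 2 ->
  weak_sharp al m (composite h wh) ->
  (forall k, eta k = eta 0%N * k.+1%:R `^ (- a)) ->
  [/\ exists2 C : R, 0 < C & forall K : nat, (1 <= K)%N ->
        Hb (x K) - Hb xs <= C * K%:R `^ (- (a * m / (m - 1))),
      exists2 C : R, 0 < C & forall K : nat, (1 <= K)%N ->
        - (C * K%:R `^ (- (a / (m - 1)))) <= Fb (x K) - Fb xs,
      exists2 C : R, 0 < C & forall K : nat, (1 <= K)%N ->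
        Fb (x K) - Fb xs <= C * K%:R `^ (- 1 - a * (3 - m) / (2 * (m - 1))) &
      exists2 C : R, 0 < C & forall K : nat, (1 <= K)%N ->
        enorm (x K - xs) ^+ 2 <= C * K%:R `^ (- (a / (m - 1)))].
Proof.
move=> m1 a0 a2 [al0 sharp] etaE.
have m10 : 0 < m - 1 by rewrite subr_gt0.
have mn0 : m - 1 != 0 by rewrite gt_eqF.
have m0 : 0 < m by apply: lt_trans m1.
pose p := (m - 1)^-1; have p0 : 0 < p by rewrite invr_gt0.
have muf0 := muf_gt0 A; have e00 := eta0 0%N.
have [V V0 step] := energy_step A Lfmuf eta0 xy.
have [M M0 HM] := upper_growth_dist A.
have [C C0 young] := powR_young M0 al0 m1.
have idom k : (0 < k)%N -> dom wf (x k) /\ dom wh (x k).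
  by case: k => // k _; exact: (iterates_dom A Lfmuf eta0 xy).
pose d k := dist (x k) X; have d0 k : 0 <= d k := dist_ge0 A (x k).
have Gd k : (0 < k)%N -> al * d k `^ m <= Hb (x k) - Hb xs.
  move=> k0; have := sharp (x k).
  by rewrite (lower_inf A) (compositeE h (wh_proper A) (idom k k0).2) -EFinB lee_fin.
have Fd k : (0 < k)%N ->
    muf / 2 * enorm (x k - xs) ^+ 2 - M * d k <= Fb (x k) - Fb xs.
  by move=> k0; apply: HM; exact: (idom k k0).1.
have Fd' k : (0 < k)%N -> - (M * d k) <= Fb (x k) - Fb xs.
  move=> k0; apply: le_trans (Fd k k0).
  by rewrite lerDr mulr_ge0 ?sqr_ge0// divr_ge0// ltW.
pose E k := Hb (x k) - Hb xs + eta k * (Fb (x k) - Fb xs + V k).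
(* The source term is of order [eta_k^(1+p) / k], that is [k^-(1 + a + a p)]; dividing by the
   contraction rate [k^-(a/2)] leaves [k^-q]. *)
pose q := 1 + a / 2 + a * p.
pose D := eta 0%N `^ (1 + p).
have D0 : 0 < D by rewrite powR_gt0.
have ap0 : 0 < a * p by rewrite mulr_gt0.
have etap k : eta k `^ (1 + p) = D * k.+1%:R `^ (- (a * (1 + p))).
  by rewrite (etaE k) powRM ?(ltW e00) ?powR_ge0// -powRrM mulNr.
have Estep k : (0 < k)%N ->
    E k.+1 <= (1 + a / k.+1%:R) * ((1 - th k) * E k)
              + (2 * C * D * a) * k.+1%:R `^ (- (q + a / 2)).
  move=> k0; have := step k k0; rewrite -/(E k).
  have := young (d k.+1) (eta k) (d0 _) (eta0 k).
  have := Fd' k.+1 isT; have := Gd k.+1 isT; have := V0 k.+1.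
  have s0 : 0 < k.+1%:R :> R by rewrite ltr0n.
  have -> : k.+1%:R `^ (- (q + a / 2)) = k.+1%:R `^ (- (a * (1 + p))) / k.+1%:R :> R.
    have -> : - (q + a / 2) = - (a * (1 + p)) + (- 1) by rewrite /q; field.
    by rewrite powRDgt0// powR_inv1// ltW.
  rewrite /E; move: (1 - th k) (Fb (x k.+1) - _) (V k.+1) (Hb (x k.+1) - _).
  move=> t F v G v0 hG hF.
  rewrite -/p etap; set s := k.+1%:R; set P := s `^ _; set Q := _ `^ m in hG *.
  have de : eta k - eta k.+1 <= a / s * eta k.
    rewrite (etaE k) (etaE k.+1); have := powR_shift_ge s0 (ltW a0).
    rewrite natr1 -(ler_pM2l e00) -/s; move: (a / s) => r; lra.
  have de0 : 0 <= eta k - eta k.+1 by rewrite subr_ge0.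
  have ek := eta0 k; have Md0 : 0 <= M * d k.+1 by rewrite mulr_ge0// ltW.
  have as0 : 0 <= a / s by rewrite divr_ge0 ?(ltW a0) ?(ltW s0).
  move: de de0 ek Md0 hF as0; rewrite -/(d _); set Md := M * d _.
  move: (eta k) (eta k.+1) (Hb (x k) - _ + _) => e e' E0 de de0 e_gt0 Md0 hF as0 hy hs.
  have eF : - (e * Md) <= e * F by rewrite -mulrN ler_pM2l.
  have ev : 0 <= e * v by rewrite mulr_ge0// ltW.
  (* The energy inequality bounds [al d^m] by [t E0 + e Md]; Young's inequality uses only half of
     it, so [e Md] is absorbed on the left, whence the factor 2. *)
  have h1 : e * Md <= t * E0 + 2 * (C * (D * P)) by lra.
  have h2 : (e - e') * (- Md) <= (e - e') * (F + v) by apply: ler_wpM2l => //; lra.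
  have h3 : (e - e') * Md <= a / s * e * Md by apply: ler_wpM2r.
  have h4 : a / s * (e * Md) <= a / s * (t * E0 + 2 * (C * (D * P))).
    by apply: ler_wpM2l.
  have -> : 2 * C * D * a * (P / s) = a / s * (2 * (C * (D * P))) by ring.
  move: (a / s) h3 h4 => r h3 h4; lra.
have b1 : a / 2 < 1 by lra.
have q0 : 0 < q by rewrite /q; lra.
have c00 : 0 < Num.sqrt (muf / (Lh + eta 0%N * Lf)).
  by rewrite sqrtr_gt0 divr_gt0 ?(muf_gt0 A)// (Lk_gt0 A Lfmuf eta0).
have theta_ge k : Num.sqrt (muf / (Lh + eta 0%N * Lf)) * Num.sqrt (eta 0%N) *
    k.+1%:R `^ (- (a / 2)) <= th k.
  apply: le_trans (theta_lower A Lfmuf eta0 etaS k).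
  rewrite -mulrA ler_pM2l// (etaE k) sqrtrM ?(ltW e00)//.
  by rewrite -[Num.sqrt (_ `^ _)]powR12_sqrt ?powR_ge0// -powRrM mulNr.
have c0 : 0 < Num.sqrt (muf / (Lh + eta 0%N * Lf)) * Num.sqrt (eta 0%N).
  by rewrite mulr_gt0// sqrtr_gt0.
have CD0 : 0 <= 2 * C * D * a.
  apply: mulr_ge0 (ltW a0); apply: mulr_ge0 (ltW D0); exact: mulr_ge0.
have [B B0 HB] := power_recursion b1 q0 c0 CD0 (ltW a0) theta_ge
  (theta_le1 A Lfmuf eta0) Estep.
have K1 K : (0 < K)%N -> 1 <= K%:R :> R by move=> K0; rewrite ler1n.
have K0' K : (0 < K)%N -> 0 < K%:R :> R by move=> K0; rewrite ltr0n.
have G1 : exists2 C1 : R, 0 < C1 & forall K, (0 < K)%N ->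
    Hb (x K) - Hb xs <= C1 * K%:R `^ (- (a * m / (m - 1))).
  (* Half of the gap of [Hb] absorbs the negative part of [Fb], so the gap is at most
     [2 E_K + 2 C eta_K^(1+p)]. The second term decides the rate, as [a < 2] makes [q] exceed
     [a (1 + p)]. *)
  exists (2 * B + 2 * C * D); first by rewrite ltr_pwDl ?mulr_gt0// !mulr_ge0// ltW.
  move=> K K0; have s1 : 1 <= K.+1%:R :> R by rewrite ler1n.
  have s0 : 0 < K.+1%:R :> R by rewrite ltr0n.
  have -> : a * m / (m - 1) = a * (1 + p) by rewrite /p; field.
  apply: (@le_trans _ _ ((2 * B + 2 * C * D) * K.+1%:R `^ (- (a * (1 + p))))); last first.
    rewrite ler_pM2l; last by rewrite ltr_pwDl ?mulr_gt0// !mulr_ge0// ltW.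
    by apply: ge_powRN; rewrite ?(K0' K)// ?ler_nat// mulr_ge0 ?addr_ge0 ?ltW.
  have := HB K K0; rewrite /E.
  have : K.+1%:R `^ (- q) <= K.+1%:R `^ (- (a * (1 + p))) :> R.
    by apply: ler_powR => //; rewrite /q; lra.
  move/(ler_wpM2l (ltW B0)).
  have := young (d K) (eta K) (d0 K) (eta0 K); rewrite etap.
  have := Gd K K0; have := ler_wpM2l (ltW (eta0 K)) (Fd' K K0).
  have : 0 <= eta K * V K by rewrite mulr_ge0 ?(ltW (eta0 K)).
  move: (_ `^ _) (_ `^ _) (_ `^ _) => Q P P'.  lra.
have ap m' : a / (m' - 1) = a * (m' - 1)^-1 by [].
have D1 : exists2 C2 : R, 0 < C2 & forall K, (0 < K)%N ->
    d K <= C2 * K%:R `^ (- (a / (m - 1))).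
  have [C1 C10 HC] := G1; exists ((C1 / al) `^ m^-1).
    by rewrite powR_gt0 ?divr_gt0.
  move=> K K0; have {1}-> : d K = (d K `^ m) `^ m^-1.
    by rewrite -powRrM divff ?gt_eqF// powRr1.
  have -> : K%:R `^ (- (a / (m - 1))) = (K%:R `^ (- (a * m / (m - 1)))) `^ m^-1 :> R.
    by rewrite -powRrM; congr (_ `^ _); field; rewrite mn0 gt_eqF.
  rewrite -powRM ?powR_ge0//; last by rewrite divr_ge0 ?ltW.
  have Cal0 : 0 <= C1 / al * K%:R `^ (- (a * m / (m - 1))).
    by rewrite mulr_ge0 ?powR_ge0// divr_ge0 ?ltW.
  apply: ge0_ler_powR; rewrite ?nnegrE ?powR_ge0 ?invr_ge0 ?(ltW m0)//.
  rewrite mulrAC ler_pdivlMr// mulrC.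
  exact: le_trans (Gd K K0) (HC K K0).
have [C2 C20 HC2] := D1.
have FU K : (0 < K)%N ->
    Fb (x K) - Fb xs <= B / eta 0%N * K%:R `^ (- 1 - a * (3 - m) / (2 * (m - 1))).
  move=> K0; have s0 : 0 < K.+1%:R :> R by rewrite ltr0n.
  (* The energy decays like [K^-q], and dividing by [eta_K] costs [K^a]. *)
  have -> : - 1 - a * (3 - m) / (2 * (m - 1)) = - (q - a) by rewrite /q /p; field.
  apply: (@le_trans _ _ (B / eta 0%N * K.+1%:R `^ (- (q - a)))); last first.
    rewrite ler_pM2l ?divr_gt0//.
    by apply: ge_powRN; rewrite ?(K0' K)// ?ler_nat// /q; lra.
  rewrite -(ler_pM2l (eta0 K)); apply: (@le_trans _ _ (E K)).
    have := le_trans (mulr_ge0 (ltW al0) (powR_ge0 (d K) m)) (Gd K K0).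
    have : 0 <= eta K * V K by rewrite mulr_ge0 ?(ltW (eta0 K)).
    by rewrite /E; lra.
  apply: (le_trans (HB K K0)); rewrite (etaE K).
  have -> : eta 0%N * K.+1%:R `^ (- a) * (B / eta 0%N * K.+1%:R `^ (- (q - a))) =
      B * (K.+1%:R `^ (- a) * K.+1%:R `^ (- (q - a))) by field; rewrite gt_eqF.
  by rewrite -powRDgt0// -opprD (addrC a) subrK.
split=> //.
- exists (M * C2); first by rewrite mulr_gt0.
  move=> K K0; apply: le_trans (Fd' K K0); rewrite lerN2 -mulrA.
  by rewrite ler_pM2l// HC2.
- by exists (B / eta 0%N) => //; rewrite divr_gt0.
- exists (2 / muf * (B / eta 0%N + M * C2)).
    by rewrite mulr_gt0 ?divr_gt0// addr_gt0 ?divr_gt0 ?mulr_gt0.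
  move=> K K0; have := Fd K K0; have := FU K K0.
  have : K%:R `^ (- 1 - a * (3 - m) / (2 * (m - 1))) <= K%:R `^ (- (a / (m - 1))) :> R.
    apply: ler_powR; first exact: K1.
    have -> : - 1 - a * (3 - m) / (2 * (m - 1)) = - (q - a) by rewrite /q /p; field.
    by rewrite ap -/p lerN2 /q; lra.
  have Be0 : 0 < B / eta 0%N by rewrite divr_gt0.
  move/(ler_wpM2l (ltW Be0)); have := ler_wpM2l (ltW M0) (HC2 K K0).
  move: (_ `^ _) (_ `^ _) (enorm _ ^+ 2) (B / _) => P Q N b *.
  have -> : 2 / muf * (b + M * C2) * Q = (muf / 2)^-1 * ((b + M * C2) * Q).
    by rewrite invf_div mulrA.
  by rewrite ler_pdivlMl ?divr_gt0//; lra.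
Qed.

End Rates.

(** Compare the quadratic lower and upper bounds of [f] at a nonzero vector, which exists as
    [0 < n]. The result ensures [theta_k <= 1]. *)
Lemma strong_convexity_le_smoothness (R : realType) (n : nat)
    (f : 'rV[R]_n -> R) (L mu : R) :
  (0 < n)%N -> smooth L f -> strongly_convex mu f -> mu <= L.
Proof.
move=> n0 fL fmu; pose v : 'rV[R]_n := const_mx 1.
have v0 : 0 < enorm (v - 0) ^+ 2.
  rewrite subr0 enorm_sqr /dot.
  under eq_bigr do rewrite mxE mulr1.
  by rewrite sumr_const card_ord ltr0n.
have := strongly_convex_gradient 0 v fL fmu; have := smooth_upper 0 v fL.
move=> h1 h2; have {h1 h2} h := le_trans h2 h1.
rewrite -(ler_pM2r v0); lra.
Qed.

Unset Implicit Arguments.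

Theorem theorem2 (R : realType) (n : nat)
    (f h : 'rV[R]_n -> R) (wf wh : 'rV[R]_n -> \bar R)
    (Lf muf Lh : R) (xs : 'rV[R]_n)
    (eta : R^nat) (x y : nat -> 'rV[R]_n) :
  bilevel_assumptions f h wf wh Lf muf Lh xs ->
  (forall k, 0 < eta k) ->
  (forall k, eta k.+1 <= eta k) ->
  IR_VFISTA f h wf wh Lf muf Lh eta x y ->
  (* (i) *)
  (eta k @[k --> \oo] --> (0 : R) ->
   (\sum_(0 <= k <oo) (Num.sqrt (eta k))%:E = +oo)%E ->
   (eta k - eta k.+1) / (eta k.+1 * Num.sqrt (eta k)) @[k --> \oo]
     --> (0 : R) ->
   x k @[k --> \oo] --> xs)
  /\
  (* (ii) *)
  (forall alpha m a : R,
   1 < m -> m <= 2 -> 0 < a -> a < 2 ->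
   weak_sharp alpha m (composite h wh) ->
   (forall k, eta k = eta 0%N * k.+1%:R `^ (- a)) ->
   [/\ exists2 C : R, 0 < C & forall K : nat, (1 <= K)%N ->
         (0 <= composite h wh (x K) - composite h wh xs <=
            (C * K%:R `^ (- (a * m / (m - 1))))%:E)%E,
       exists C1 C2 : R, [/\ 0 < C1, 0 < C2 & forall K : nat, (1 <= K)%N ->
         ((- (C1 * K%:R `^ (- (a / (m - 1)))))%:E <=
            composite f wf (x K) - composite f wf xs <=
            (C2 * K%:R `^ (- 1 - a * (3 - m) / (2 * (m - 1))))%:E)%E] &
       exists2 C : R, 0 < C & forall K : nat, (1 <= K)%N ->
         enorm (x K - xs) ^+ 2 <= C * K%:R `^ (- (a / (m - 1)))]).
Proof.
move=> A eta0 etaS xy.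
have Dxs := solution_dom A.
(* [muf <= Lf] may fail for [n = 0]. *)
have [n0|n0] := posnP n.
  have eqv (u v : 'rV[R]_n) : u = v.
    by apply/rowP => i; exfalso; move: (ltn_ord i); rewrite {2}n0.
  split=> [_ _ _|al m a _ _ _ _ _ _].
    by rewrite (_ : x = cst xs); [exact: cvg_cst|apply/funext => k; exact: eqv].
  split.
  - exists 1 => // K _; rewrite (eqv (x K) xs) (compositeE h (wh_proper A) Dxs.2).
    by rewrite -EFinB subrr !lee_fin lexx mul1r powR_ge0.
  - exists 1, 1; split=> // K _; rewrite (eqv (x K) xs) (compositeE f (wf_proper A) Dxs.1).
    by rewrite -EFinB subrr !lee_fin !mul1r oppr_le0 !powR_ge0.
  - exists 1 => // K _; rewrite (eqv (x K - xs) 0) enorm_sqr mul1r /dot big1 ?powR_ge0//.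
    by move=> i _; rewrite mxE mulr0.
have Lfmuf := strong_convexity_le_smoothness n0 (f_smooth A) (f_strongly_convex A).
split; first exact: (iterates_cvg A Lfmuf eta0 etaS xy).
move=> al m a m1 _ a0 a2 sharp etaE.
have [[C1 C10 H1] [C2 C20 H2] [C3 C30 H3] H4] :=
  rates A Lfmuf eta0 etaS xy m1 a0 a2 sharp etaE.
have idom K : (1 <= K)%N -> dom wf (x K) /\ dom wh (x K).
  by case: K => // K _; exact: (iterates_dom A Lfmuf eta0 xy).
split=> //.
- exists C1 => // K K1; rewrite (compositeE h (wh_proper A) Dxs.2).
  rewrite (compositeE h (wh_proper A) (idom K K1).2) -EFinB !lee_fin H1// andbT.
  by rewrite subr_ge0; exact: (lower_gap_ge0 A (idom K K1).2).
- exists C2, C3; split=> // K K1; rewrite (compositeE f (wf_proper A) Dxs.1).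
  by rewrite (compositeE f (wf_proper A) (idom K K1).1) -EFinB !lee_fin H2// H3.
Qed.
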